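(* Let $S$ be a finitely generated standard graded algebra over a commutative ring $R$, let $I$ be a finitely generated ideal of $R$, let $M$ be a graded $S$-module and let $d$ be an integer. Assume that $\operatorname{depth}_I(M_\mu)\geq d$ for all $\mu\gg 0$. Then: (i) $\operatorname{depth}_I(M_\mu)\geq d$ for any $\mu$ such that $H^q_{S_+}(M)_\mu=0$ for all $q<d$; (ii) if $\operatorname{depth}_I(M_\mu)=d$ for some $\mu$ such that $H^q_{S_+}(M)_\mu=0$ for all $q\leq d$, then $\operatorname{depth}_I(M_\nu)\leq d$ for any $\nu\geq\mu$.
   Context: No Noetherian hypothesis is made. $S=\bigoplus_{\mu\ge0}S_\mu$ is graded with $S_0=R$, generated as an $R$-algebra by finitely many elements of $S_1$; $S_+=\bigoplus_{\mu>0}S_\mu$. Graded modules are $\mathbf{Z}$-graded and not assumed finitely generated; $M_\mu$ is the degree $\mu$ component, an $R$-module. For a commutative ring $A$, a finitely generated ideal $I=(a_1,\dots,a_r)$ and an $A$-module $N$, $H^i_I(N)$ denotes the $i$-th cohomology module of the Čech complex of $N$ on $a_1,\dots,a_r$ (up to isomorphism independent of the choice of generators, and naturally graded in the graded case). The depth is $\operatorname{depth}_I(N):=\max\{p\in\mathbf{N}\cup\{+\infty\}\mid H^i_I(N)=0\ \forall i<p\}$. *)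

(* Defs.v *)
From HB Require Import structures.
From mathcomp Require Import all_boot all_order all_algebra.
From mathcomp Require Import boolp classical_sets constructive_ereal zify.

Set Implicit Arguments.
Unset Strict Implicit.
Unset Printing Implicit Defensive.

Import Order.TTheory GRing.Theory Num.Theory.
Local Open Scope quotient_scope.
Local Open Scope classical_set_scope.
Local Open Scope ring_scope.

Section Localization.
Variables (A : comPzRingType) (N : lmodType A) (f : A).
Implicit Types u v w : N * nat.

(* The pair (m, k) stands for the fraction m / f ^+ k. *)
Definition loc_eq u v : bool :=
  `[< exists l : nat, f ^+ l *: (f ^+ v.2 *: u.1) = f ^+ l *: (f ^+ u.2 *: v.1) >].

Lemma loc_eq_equiv : equiv_class_of loc_eq.
Proof.
split=> [u|u v|v u w].
- by apply/asboolP; exists 0%N.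
- by apply/asboolP/asboolP => -[l e]; exists l.
move=> /asboolP[l e] /asboolP[l' e']; apply/asboolP; exists (l + l' + v.2)%N.
rewrite !scalerA -!exprD in e e' *.
rewrite (_ : _ + w.2 = (l' + w.2) + (l + v.2))%N; last by lia.
rewrite exprD -scalerA e scalerA -exprD.
rewrite (_ : l' + _ + _ = (l + u.2) + (l' + w.2))%N; last by lia.
rewrite exprD -scalerA e' scalerA -exprD; congr (f ^+ _ *: _); lia.
Qed.

Canonical loc_eq_equivRel := EquivRelPack loc_eq_equiv.
Canonical loc_eq_encModRel := defaultEncModRel loc_eq.

Definition loc := {eq_quot loc_eq}.
HB.instance Definition _ : EqQuotient (N * nat)%type loc_eq loc := EqQuotient.on loc.
HB.instance Definition _ := Choice.on loc.

Definition frac (m : N) (k : nat) : loc := \pi_loc (m, k).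

Lemma fracP m k m' k' :
  frac m k = frac m' k' <->
  exists l : nat, f ^+ l *: (f ^+ k' *: m) = f ^+ l *: (f ^+ k *: m').
Proof.
split=> [/eqP|h]; first by rewrite piE => /asboolP.
by apply/eqP; rewrite piE; apply/asboolP.
Qed.

Lemma fracE (z : loc) : frac (repr z).1 (repr z).2 = z.
Proof. by rewrite /frac -surjective_pairing reprK. Qed.

Lemma frac_ind (P : loc -> Prop) : (forall m k, P (frac m k)) -> forall z, P z.
Proof. by move=> h z; rewrite -[z]fracE. Qed.

Definition loc_opp (z : loc) : loc := frac (- (repr z).1) (repr z).2.
Definition loc_add (z w : loc) : loc :=
  frac (f ^+ (repr w).2 *: (repr z).1 + f ^+ (repr z).2 *: (repr w).1)
       ((repr z).2 + (repr w).2).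
Definition loc_scale (b : A) (z : loc) : loc := frac (b *: (repr z).1) (repr z).2.

Lemma frac_repr m k : exists l : nat,
  f ^+ (l + k) *: (repr (frac m k)).1 = f ^+ (l + (repr (frac m k)).2) *: m.
Proof.
have /fracP[l] : frac (repr (frac m k)).1 (repr (frac m k)).2 = frac m k.
  exact: fracE.
by rewrite !scalerA -!exprD => e; exists l.
Qed.

Lemma loc_oppE m k : loc_opp (frac m k) = frac (- m) k.
Proof.
apply/fracP; have [l e] := frac_repr m k; exists l.
by rewrite !scalerA -!exprD !scalerN e.
Qed.

Lemma loc_scaleE b m k : loc_scale b (frac m k) = frac (b *: m) k.
Proof.
apply/fracP; have [l e] := frac_repr m k; exists l.
by rewrite !scalerA -!exprD !(mulrC _ b) -!scalerA e.
Qed.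

Lemma loc_addE m k m' k' :
  loc_add (frac m k) (frac m' k') =
  frac (f ^+ k' *: m + f ^+ k *: m') (k + k').
Proof.
rewrite /loc_add; set u := repr (frac m k); set u' := repr (frac m' k').
apply/fracP; have [l e] := frac_repr m k; have [l' e'] := frac_repr m' k'.
rewrite -/u -/u' in e e'; exists (l + l')%N.
rewrite !scalerA -!exprD !scalerDr !scalerA -!exprD; congr (_ + _).
  rewrite (_ : _ + _ = (l' + k' + u'.2) + (l + k))%N; last by lia.
  by rewrite exprD -scalerA e scalerA -exprD; congr (f ^+ _ *: _); lia.
rewrite (_ : _ + _ = (l + k + u.2) + (l' + k'))%N; last by lia.
by rewrite exprD -scalerA e' scalerA -exprD; congr (f ^+ _ *: _); lia.
Qed.

Lemma frac_mul l m k : frac (f ^+ l *: m) (l + k) = frac m k.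
Proof.
by apply/fracP; exists 0%N; rewrite !scalerA -!exprD; congr (f ^+ _ *: _); lia.
Qed.

Lemma loc_addA : associative loc_add.
Proof.
elim/frac_ind=> m k; elim/frac_ind=> m' k'; elim/frac_ind=> m'' k''.
rewrite !loc_addE !scalerDr !scalerA -!exprD addrA addnA.
by congr (frac (f ^+ _ *: _ + f ^+ _ *: _ + _) _); lia.
Qed.

Lemma loc_addC : commutative loc_add.
Proof.
by elim/frac_ind=> m k; elim/frac_ind=> m' k'; rewrite !loc_addE addrC addnC.
Qed.

Lemma loc_add0 : left_id (frac 0 0) loc_add.
Proof. by elim/frac_ind=> m k; rewrite loc_addE scaler0 add0r scale1r. Qed.

Lemma loc_addN : left_inverse (frac 0 0) loc_opp loc_add.
Proof.
elim/frac_ind=> m k; rewrite loc_oppE loc_addE scalerN addNr.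
by apply/fracP; exists 0%N; rewrite !scaler0.
Qed.

HB.instance Definition _ :=
  GRing.isZmodule.Build loc loc_addA loc_addC loc_add0 loc_addN.

Lemma fracD m k m' k' :
  frac m k + frac m' k' = frac (f ^+ k' *: m + f ^+ k *: m') (k + k').
Proof. exact: loc_addE. Qed.

Lemma loc_scaleA b c z : loc_scale b (loc_scale c z) = loc_scale (b * c) z.
Proof. by elim/frac_ind: z => m k; rewrite !loc_scaleE scalerA. Qed.

Lemma loc_scale1 : left_id 1 loc_scale.
Proof. by elim/frac_ind=> m k; rewrite !loc_scaleE scale1r. Qed.

Lemma loc_scaleDr : right_distributive loc_scale +%R.
Proof.
move=> b; elim/frac_ind=> m k; elim/frac_ind=> m' k'.
rewrite fracD !loc_scaleE fracD scalerDr !scalerA.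
by congr (frac (_ *: _ + _ *: _) _); rewrite mulrC.
Qed.

Lemma loc_scaleDl z : {morph loc_scale^~ z : b c / b + c}.
Proof.
elim/frac_ind: z => m k b c.
rewrite !loc_scaleE fracD -scalerDr -scalerDl.
by rewrite frac_mul.
Qed.

HB.instance Definition _ := GRing.Zmodule_isLmodule.Build A loc
  loc_scaleA loc_scale1 loc_scaleDr loc_scaleDl.

Lemma fracZ b m k : b *: frac m k = frac (b *: m) k.
Proof. exact: loc_scaleE. Qed.

Lemma frac0 k : frac 0 k = 0.
Proof. by apply/fracP; exists 0%N; rewrite !scaler0. Qed.

End Localization.

(* For g = f * h this is the canonical map N_f -> N_g,
   m / f ^+ k |-> (h ^+ k *: m) / g ^+ k. *)
Definition loc_res (A : comPzRingType) (N : lmodType A) (f h g : A)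
    (z : loc N f) : loc N g :=
  frac g (h ^+ (repr z).2 *: (repr z).1) (repr z).2.

Section LocRes.
Variables (A : comPzRingType) (N : lmodType A) (f h g : A).
Hypothesis g_eq : g = f * h.

Lemma loc_resE m k : loc_res h g (frac f m k) = frac g (h ^+ k *: m) k :> loc N g.
Proof.
apply/fracP; have [l e] := frac_repr f m k; exists l.
rewrite !scalerA -!exprD g_eq !exprMn -!mulrA -!exprD.
rewrite !(mulrC (f ^+ _)) -!scalerA e.
by congr (h ^+ _ *: _); lia.
Qed.

Lemma loc_res_linear : linear (@loc_res A N f h g).
Proof.
move=> b; elim/frac_ind=> m k; elim/frac_ind=> m' k'.
rewrite fracZ fracD !loc_resE fracZ fracD g_eq scalerDr !scalerA !exprMn exprD.
congr (frac _ (_ *: _ + _ *: _) _).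
  by rewrite [LHS](ACl (3*2*4*1)%AC).
by rewrite [LHS](ACl (3*1*2)%AC).
Qed.

End LocRes.

(* N need not be finitely generated and A may be the zero ring. The cohomology
   and the depth are attached to a family a of generators of the ideal. *)
Section Cech.
Variables (A : comPzRingType) (r : nat) (a : 'I_r -> A) (N : lmodType A).

Definition set_prod (J : {set 'I_r}) : A := \prod_(i in J) a i.

(* Cochains of all degrees at once: families indexed by the subsets J of
   the index set, with values in the localization of N at the product of the
   a i for i in J. The degree is the number of elements of J. *)
Definition cech := {dffun forall J : {set 'I_r}, loc N (set_prod J)}.
HB.instance Definition _ := Choice.on cech.

Definition cech_zero : cech := [ffun J => 0].
Definition cech_opp (c : cech) : cech := [ffun J => - c J].
Definition cech_add (c b : cech) : cech := [ffun J => c J + b J].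
Definition cech_scale (t : A) (c : cech) : cech := [ffun J => t *: c J].

Lemma cech_addA : associative cech_add.
Proof. by move=> x y z; apply/ffunP => J; rewrite !ffunE addrA. Qed.
Lemma cech_addC : commutative cech_add.
Proof. by move=> x y; apply/ffunP => J; rewrite !ffunE addrC. Qed.
Lemma cech_add0 : left_id cech_zero cech_add.
Proof. by move=> x; apply/ffunP => J; rewrite !ffunE add0r. Qed.
Lemma cech_addN : left_inverse cech_zero cech_opp cech_add.
Proof. by move=> x; apply/ffunP => J; rewrite !ffunE addNr. Qed.

HB.instance Definition _ :=
  GRing.isZmodule.Build cech cech_addA cech_addC cech_add0 cech_addN.

Lemma cech_scaleA s t c : cech_scale s (cech_scale t c) = cech_scale (s * t) c.
Proof. by apply/ffunP => J; rewrite !ffunE scalerA. Qed.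
Lemma cech_scale1 : left_id 1 cech_scale.
Proof. by move=> c; apply/ffunP => J; rewrite !ffunE scale1r. Qed.
Lemma cech_scaleDr : right_distributive cech_scale +%R.
Proof. by move=> s x y; apply/ffunP => J; rewrite !ffunE scalerDr. Qed.
Lemma cech_scaleDl c : {morph cech_scale^~ c : s t / s + t}.
Proof. by move=> s t; apply/ffunP => J; rewrite !ffunE scalerDl. Qed.

HB.instance Definition _ := GRing.Zmodule_isLmodule.Build A cech
  cech_scaleA cech_scale1 cech_scaleDr cech_scaleDl.

Definition cech_diff (c : cech) : cech :=
  [ffun J : {set 'I_r} => \sum_(i in J)
     (-1) ^+ #|[pred j in J | (j < i)%N]| *:
     loc_res (a i) (set_prod J) (c (J :\ i))].

Lemma cech_diff_linear : linear cech_diff.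
Proof.
move=> t c b; apply/ffunP => J; rewrite !ffunE scaler_sumr -big_split /=.
apply: eq_bigr => i iJ; rewrite !ffunE.
have pE : set_prod J = set_prod (J :\ i) * a i.
  by rewrite /set_prod (big_setD1 i) //= mulrC.
rewrite (loc_res_linear pE) scalerDr; congr (_ + _).
by rewrite !scalerA mulrC.
Qed.
HB.instance Definition _ :=
  GRing.isLinear.Build A cech cech _ cech_diff cech_diff_linear.

Definition cochain (p : nat) : set cech :=
  [set c | forall J : {set 'I_r}, #|J| <> p -> c J = 0].

Definition cocycle (p : nat) : {pred cech} :=
  fun c => `[< cochain p c /\ cech_diff c = 0 >].

Lemma cocycle_closed p : subsemimod_closed (cocycle p).
Proof.
split.
  split.
    apply/asboolP; split; last exact: raddf0.
    by move=> J _; rewrite ffunE.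
  move=> x y /asboolP[x1 x2] /asboolP[y1 y2]; apply/asboolP; split.
    by move=> J hJ; rewrite ffunE x1 ?y1 ?addr0.
  by rewrite raddfD /= x2 y2 addr0.
move=> t x /asboolP[x1 x2]; apply/asboolP; split.
  by move=> J hJ; rewrite ffunE x1 ?scaler0.
by rewrite linearZ /= x2 scaler0.
Qed.
HB.instance Definition _ p :=
  GRing.isSubmodClosed.Build A cech (cocycle p) (cocycle_closed p).

Definition cocycles p := {c : cech | cocycle p c}.
HB.instance Definition _ p := SubChoice.on (cocycles p).
HB.instance Definition _ p :=
  [SubChoice_isSubLmodule of cocycles p by <:].

(* b is a cochain of degree p - 1; for p = 0 this forces b = 0. *)
Definition coboundary (p : nat) : {pred cocycles p} :=
  fun z => `[< exists2 b : cech,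
    (forall J : {set 'I_r}, #|J|.+1 <> p -> b J = 0) & val z = cech_diff b >].

Lemma coboundary_closed p : subsemimod_closed (@coboundary p).
Proof.
split.
  split.
    by apply/asboolP; exists 0; rewrite ?raddf0 // => J _; rewrite ffunE.
  move=> x y /asboolP[b hb xb] /asboolP[c hc yc]; apply/asboolP.
  exists (b + c); last by rewrite !raddfD /= xb yc.
  by move=> J hJ; rewrite ffunE hb ?hc ?addr0.
move=> t x /asboolP[b hb xb]; apply/asboolP.
exists (t *: b); last by rewrite !linearZ /= xb.
by move=> J hJ; rewrite ffunE hb ?scaler0.
Qed.
HB.instance Definition _ p :=
  GRing.isSubmodClosed.Build A (cocycles p) (@coboundary p) (@coboundary_closed p).

Definition cohomology (p : nat) :=
  Quotient.quot [the zmodClosed (cocycles p) of @coboundary p].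
HB.instance Definition _ p := GRing.Zmodule.on (cohomology p).
HB.instance Definition _ p := EqQuotient.on (cohomology p).

Definition coho_class (p : nat) (z : cocycles p) : cohomology p :=
  \pi_(cohomology p) z.

Lemma coho_classP p (z w : cocycles p) :
  coho_class z = coho_class w <-> coboundary (z - w).
Proof.
by split=> [/eqP|h]; [|apply/eqP]; rewrite -[_ == _]Quotient.idealrBE.
Qed.

Lemma coho_class_repr p (x : cohomology p) : coho_class (repr x) = x.
Proof. exact: reprK. Qed.

Lemma coho_classD p : {morph @coho_class p : z w / z + w}.
Proof. exact: Quotient.pi_add. Qed.

Definition coho_scale p (t : A) (x : cohomology p) : cohomology p :=
  coho_class (t *: repr x).

Lemma coho_scaleE p t (z : cocycles p) :
  coho_scale t (coho_class z) = coho_class (t *: z).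
Proof.
apply/coho_classP; rewrite -scalerBr; apply: (@rpredZ _ _ (@coboundary p)).
by apply/coho_classP; rewrite coho_class_repr.
Qed.

Lemma coho_scaleA p s t (x : cohomology p) :
  coho_scale s (coho_scale t x) = coho_scale (s * t) x.
Proof. by rewrite -[x]coho_class_repr !coho_scaleE scalerA. Qed.
Lemma coho_scale1 p : left_id 1 (@coho_scale p).
Proof. by move=> x; rewrite -[x]coho_class_repr !coho_scaleE scale1r. Qed.
Lemma coho_scaleDr p : right_distributive (@coho_scale p) +%R.
Proof.
move=> s x y; rewrite -[x]coho_class_repr -[y]coho_class_repr -coho_classD.
by rewrite !coho_scaleE scalerDr coho_classD.
Qed.
Lemma coho_scaleDl p (x : cohomology p) : {morph (@coho_scale p)^~ x : s t / s + t}.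
Proof.
by move=> s t; rewrite -[x]coho_class_repr !coho_scaleE scalerDl coho_classD.
Qed.
HB.instance Definition _ p := GRing.Zmodule_isLmodule.Build A (cohomology p)
  (@coho_scaleA p) (@coho_scale1 p) (@coho_scaleDr p) (@coho_scaleDl p).

(* The set of the p in N \cup {+oo} such that H^i = 0 for all i < p always has
   a maximum (it contains 0); the default value 0 is never used. *)
Definition depth : \bar int :=
  let D := [set p : \bar int |
    (p = +oo%E \/ exists n : nat, p = (n%:Z)%:E) /\
    forall i : nat, ((i%:Z)%:E < p)%E -> forall x : cohomology i, x = 0] in
  xget 0%E (D `&` ubound D).

End Cech.

Definition direct_sum (I : eqType) (V : zmodType) (W : I -> set V) : Prop :=
  [/\ forall i, W i 0 /\ (forall x y, W i x -> W i y -> W i (x - y)),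
      forall x, exists (s : seq I) (c : I -> V),
        [/\ uniq s, forall i, W i (c i) & x = \sum_(i <- s) c i]
    & forall (s : seq I) (c : I -> V), uniq s -> (forall i, W i (c i)) ->
        \sum_(i <- s) c i = 0 -> forall i, i \in s -> c i = 0].

Record standardGradedAlgebra (R S : comPzRingType) := StandardGradedAlgebra {
  scal : {rmorphism R -> S};
  alg_part : nat -> set S;
  alg_part_direct : direct_sum alg_part;
  alg_partM : forall i j s t,
    alg_part i s -> alg_part j t -> alg_part (i + j) (s * t);
  scal_inj : injective scal;
  alg_part0 : alg_part 0%N = range scal;
  (* S is the smallest R-subalgebra containing the x i. *)
  alg_part1_gen : exists (n : nat) (x : 'I_n -> S),
    (forall i, alg_part 1 (x i)) /\
    smallest (fun T : set S =>
        [/\ range scal `<=` T,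
            forall s t, T s -> T t -> T (s + t)
          & forall s t, T s -> T t -> T (s * t)])
      (range x) = setT
}.

Section Graded.
Variables (R S : comPzRingType) (gS : standardGradedAlgebra R S).

Definition irrelevant_ideal : set S :=
  [set s | exists (n : nat) (c : nat -> S),
    (forall i, alg_part gS i (c i)) /\ s = \sum_(1 <= i < n) c i].

Record gradedModule (M : lmodType S) := GradedModule {
  mod_part : int -> set M;
  mod_part_direct : direct_sum mod_part;
  mod_partZ : forall i j s m,
    alg_part gS i s -> mod_part j m -> mod_part (i%:Z + j) (s *: m)
}.

Section Component.
Variables (M : lmodType S) (gM : gradedModule M) (mu : int).

Definition mod_part_pred : {pred M} := fun m => `[< mod_part gM mu m >].

Lemma mod_part_closed : zmod_closed mod_part_pred.
Proof.
have [h _ _] := mod_part_direct gM; have [h0 hB] := h mu.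
by split=> [|x y /asboolP hx /asboolP hy]; apply/asboolP; [|apply: hB].
Qed.
HB.instance Definition _ := GRing.isZmodClosed.Build M mod_part_pred mod_part_closed.

Definition component := {m : M | mod_part_pred m}.
HB.instance Definition _ := SubChoice.on component.
HB.instance Definition _ := [SubChoice_isSubZmodule of component by <:].

Lemma component_scale_subproof (t : R) (m : component) :
  mod_part_pred (scal gS t *: val m).
Proof.
apply/asboolP; rewrite -[mu]add0r; apply: (mod_partZ (i := 0%N)).
  by rewrite alg_part0; exists t.
exact/asboolP/(valP m).
Qed.

Definition component_scale (t : R) (m : component) : component :=
  exist _ (scal gS t *: val m) (component_scale_subproof t m).

Lemma component_scaleA s t m :
  component_scale s (component_scale t m) = component_scale (s * t) m.
Proof. by apply: val_inj; rewrite /= scalerA rmorphM. Qed.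
Lemma component_scale1 : left_id 1 component_scale.
Proof. by move=> m; apply: val_inj; rewrite /= rmorph1 scale1r. Qed.
Lemma component_scaleDr : right_distributive component_scale +%R.
Proof. by move=> s x y; apply: val_inj; rewrite /= -scalerDr. Qed.
Lemma component_scaleDl m : {morph component_scale^~ m : s t / s + t}.
Proof. by move=> s t; apply: val_inj; rewrite /= rmorphD scalerDl. Qed.

HB.instance Definition _ := GRing.Zmodule_isLmodule.Build R component
  component_scaleA component_scale1 component_scaleDr component_scaleDl.

End Component.

Section GradedCech.
Variables (M : lmodType S) (gM : gradedModule M).
Variables (n : nat) (y : 'I_n -> S) (e : 'I_n -> nat).

(* Each y i is meant to be homogeneous of degree e i. The degree mu part of a
   localization consists of the m / f ^+ k with m homogeneous of degree
   mu + k deg f; a cochain has degree mu when all its components do. *)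
Definition cech_part (mu : int) : set (cech y M) :=
  [set c | forall J : {set 'I_n}, exists (m : M) (k : nat),
    mod_part gM (mu + (k * \sum_(i in J) e i)%N%:Z) m /\
    c J = frac (set_prod y J) m k].

Definition cohomology_part (q : nat) (mu : int) : set (cohomology y M q) :=
  [set coho_class z | z in [set z : cocycles y M q | cech_part mu (val z)]].

End GradedCech.
End Graded.
Arguments cohomology_part {R S gS M} gM {n} y e q mu.
Arguments cech_part {R S gS M} gM {n} y e mu.

Definition ideal_span (A : comPzRingType) (n : nat) (y : 'I_n -> A) : set A :=
  [set s | exists c : 'I_n -> A, s = \sum_i c i * y i].

(* Main.v *)
Require Import Defs.
From HB Require Import structures.
From mathcomp Require Import all_boot all_order all_algebra.
From mathcomp Require Import boolp classical_sets constructive_ereal zify.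
Import Defs.

Set Implicit Arguments.
Unset Strict Implicit.
Unset Printing Implicit Defensive.

Import Order.TTheory GRing.Theory Num.Theory.
Local Open Scope classical_set_scope.
Local Open Scope ring_scope.

(** Let N^q be the degree mu part of the module of Cech cochains of degree q of M
    with respect to the generators of S_+, as an R-module. The hypothesis on the
    cohomology with respect to S_+ says that the complex
      0 -> M_mu -> N^1 -> N^2 -> ...
    is exact in the relevant range (cohomology_part_exact). On the other hand,
    for q > 0 the module N^q is a finite direct sum of modules (M_f)_mu with f a
    product of generators, of positive degree unless f = 0, and (M_f)_mu is the
    colimit of the components of M of degrees mu + l deg f. As Cech cohomology
    commutes with sums and colimits, and the depth of the components of large
    degree is at least d, one gets H^p_I(N^q) = 0 for p < d and q > 0
    (acyclic_cech_piece).

    The Cech complexes on the generators of I, taken of all the terms of the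
    complex above, form a double complex. A diagram chase along its diagonal
    (staircase) shows: if H^i_I(N^q) = 0 for i < p and q > 0 and the complex above
    is exact up to degree p, then H^p_I(M_mu) -> H^p_I(N^1) is injective
    (bounds_of_augmented).

    Part (i) follows, since the target vanishes for p < d. For (ii) take p = d,
    and suppose that H^d_I(M_nu) = 0 for some nu = mu + k. Then every element of
    degree k of S kills H^d_I(M_mu), hence so does every homogeneous element of
    larger degree, because S is standard graded (acyclic_bounds_mul). In
    particular powers of the generators y_i do. So every class of H^d_I(M_mu)
    dies in the localizations (M_{y_i})_mu, whose sum is N^1
    (augmented_bounds). By injectivity H^d_I(M_mu) = 0, and the depth of M_mu
    exceeds d. *)

(** * Functoriality of localization and of the Cech complex *)

Section LocMap.
Variables (A : comPzRingType).
Implicit Types (N : lmodType A) (f : A).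

Definition loc_map N N' f (g : N -> N') (z : loc N f) : loc N' f :=
  frac f (g (repr z).1) (repr z).2.

Lemma loc_mapE N N' f (g : {linear N -> N'}) m k :
  loc_map g (frac f m k) = frac f (g m) k.
Proof.
apply/fracP; have [l e] := frac_repr f m k; exists l.
by rewrite !scalerA -!exprD -!linearZ e.
Qed.

Lemma loc_map_linear N N' f (g : {linear N -> N'}) :
  linear (@loc_map N N' f g).
Proof.
move=> b; elim/frac_ind=> m k; elim/frac_ind=> m' k'.
by rewrite fracZ fracD !loc_mapE fracZ fracD linearD !(linearZ_LR g).
Qed.

HB.instance Definition _ N N' f (g : {linear N -> N'}) :=
  GRing.isLinear.Build A (loc N f) (loc N' f) _ (@loc_map N N' f g)
    (@loc_map_linear N N' f g).

(** Localization is exact: if v m / f ^+ k vanishes then f ^+ l *: m is in the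
    kernel of v for some l, and a preimage of it divided by f ^+ (l + k) does. *)
Lemma loc_map_exact N N' N'' f (u : {linear N -> N'}) (v : {linear N' -> N''})
    (z : loc N' f) :
  (forall x, v x = 0 -> exists w, u w = x) -> loc_map v z = 0 ->
  exists w : loc N f, loc_map u w = z.
Proof.
move=> ex; elim/frac_ind: z => m k; rewrite loc_mapE -(frac0 N'' f 0).
case/fracP=> l; rewrite scale1r !scaler0 -linearZ => /ex[w uw].
exists (frac f w (l + k)); rewrite loc_mapE uw; exact: frac_mul.
Qed.

Lemma loc_map_inj N N' f (v : {linear N -> N'}) (z : loc N f) :
  (forall x, v x = 0 -> x = 0) -> loc_map v z = 0 -> z = 0.
Proof.
move=> inj; elim/frac_ind: z => m k; rewrite loc_mapE -(frac0 N' f 0).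
case/fracP=> l; rewrite scale1r !scaler0 -linearZ => /inj e.
by rewrite -(frac_mul f l) e frac0.
Qed.

Definition frac_lin N f k (m : N) : loc N f := frac f m k.

Lemma frac_lin_linear N f k : linear (@frac_lin N f k).
Proof.
by move=> t x z; rewrite /frac_lin fracZ fracD -scalerDr frac_mul.
Qed.

HB.instance Definition _ N f k :=
  GRing.isLinear.Build A N (loc N f) _ (@frac_lin N f k)
    (@frac_lin_linear N f k).

Lemma loc_res_map N N' f h g (u : {linear N -> N'}) (z : loc N f) : g = f * h ->
  loc_res h g (loc_map u z) = loc_map u (loc_res h g z).
Proof.
move=> gE; elim/frac_ind: z => m k.
by rewrite loc_mapE !(loc_resE gE) loc_mapE linearZ.
Qed.

End LocMap.

Section CechMap.
Variables (A : comPzRingType) (r : nat) (a : 'I_r -> A).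
Implicit Types (N : lmodType A).

Lemma set_prodD1 (J : {set 'I_r}) i : i \in J ->
  set_prod a J = set_prod a (J :\ i) * a i.
Proof. by move=> iJ; rewrite /set_prod (big_setD1 i) //= mulrC. Qed.

Definition cech_map N N' (g : N -> N') (c : cech a N) : cech a N' :=
  [ffun K => loc_map g (c K)].

Lemma cech_map_linear N N' (g : {linear N -> N'}) : linear (cech_map g).
Proof. by move=> t x y; apply/ffunP=> K; rewrite !ffunE linearP. Qed.

HB.instance Definition _ N N' (g : {linear N -> N'}) :=
  GRing.isLinear.Build A (cech a N) (cech a N') _ (cech_map g)
    (@cech_map_linear N N' g).

Lemma cech_map_diff N N' (g : {linear N -> N'}) c :
  cech_diff (cech_map g c) = cech_map g (cech_diff c).
Proof.
apply/ffunP=> J; rewrite !ffunE linear_sum; apply: eq_bigr => i iJ.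
by rewrite ffunE loc_res_map ?linearZ //; apply: set_prodD1.
Qed.

Lemma cech_map_eq N N' (g h : N -> N') : g =1 h -> cech_map g =1 cech_map h.
Proof. by move=> e c; apply/ffunP=> K; rewrite !ffunE /loc_map e. Qed.

Lemma cech_map0 N N' (g : N -> N') c : (forall x, g x = 0) -> cech_map g c = 0.
Proof. by move=> e; apply/ffunP=> K; rewrite !ffunE /loc_map e frac0. Qed.

Lemma cech_map_comp N N' N'' (g : {linear N -> N'}) (h : {linear N' -> N''}) c :
  cech_map (h \o g) c = cech_map h (cech_map g c).
Proof.
apply/ffunP=> K; rewrite !ffunE; elim/frac_ind: (c K) => m k.
by rewrite !loc_mapE.
Qed.

Lemma cech_map_id N c : cech_map (@id N) c = c.
Proof. by apply/ffunP=> K; rewrite !ffunE /loc_map fracE. Qed.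

Lemma cech_sumE N (T : finType) (F : T -> cech a N) K :
  (\sum_t F t) K = \sum_t F t K.
Proof. by elim/big_rec2: _ => [|t x z _ <-]; rewrite ffunE. Qed.

Lemma cech_map_sum N N' (T : finType) (g : T -> {linear N -> N'}) c :
  cech_map (fun x => \sum_t g t x) c = \sum_t cech_map (g t) c.
Proof.
apply/ffunP=> K; rewrite cech_sumE ffunE.
under [RHS]eq_bigr do rewrite ffunE.
rewrite -[c K]fracE; set m := _.1; set k := _.2.
have lin : linear (fun x => \sum_t g t x).
  move=> b x y; rewrite scaler_sumr -big_split.
  by apply: eq_bigr => t _; rewrite linearP.
pose L : {linear N -> N'} := HB.pack (fun x => \sum_t g t x)
  (GRing.isLinear.Build _ _ _ _ _ lin).
rewrite (loc_mapE _ L) /=.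
under [RHS]eq_bigr do rewrite loc_mapE.
elim/big_rec2: _ => [|t x y _ <-]; first by rewrite frac0.
by rewrite fracD -scalerDr frac_mul addrC.
Qed.

(** Exactness is applied separately in the localization at each index set; the
    lift can be taken to vanish wherever c does, so it keeps the degree of c. *)
Lemma cech_map_exact N N' N'' (u : {linear N -> N'}) (v : {linear N' -> N''})
    (c : cech a N') :
  (forall x, v x = 0 -> exists w, u w = x) -> cech_map v c = 0 ->
  exists2 b, cech_map u b = c & forall K, c K = 0 -> b K = 0.
Proof.
move=> ex vc0.
have lift K : exists b : loc N (set_prod a K),
    loc_map u b = c K /\ (c K = 0 -> b = 0).
  case: (pselect (c K = 0)) => [->|cK].
    by exists 0; split=> //; exact: (linear0 (loc_map u)).
  have [|w uw] := @loc_map_exact _ _ _ _ _ u v (c K) ex; last by exists w.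
  by move/ffunP/(_ K): vc0; rewrite !ffunE.
pose b K := sval (cid (lift K)); have bP K := svalP (cid (lift K)).
exists [ffun K => b K].
  by apply/ffunP=> K; rewrite !ffunE; case: (bP K).
by move=> K cK; rewrite ffunE; case: (bP K) => _; apply.
Qed.

Lemma cech_map_inj N N' (v : {linear N -> N'}) (c : cech a N) :
  (forall x, v x = 0 -> x = 0) -> cech_map v c = 0 -> c = 0.
Proof.
move=> inj /ffunP vc0; apply/ffunP=> K; rewrite [RHS]ffunE.
by apply: (loc_map_inj inj); move: (vc0 K); rewrite !ffunE.
Qed.

End CechMap.

(** * Cocycles and coboundaries *)

Section CechComplex.
Variables (A : comPzRingType) (r : nat) (a : 'I_r -> A) (N : lmodType A).
Implicit Types (c b : cech a N) (p : nat).

(** The terms that remove i and j in the two possible orders cancel: removing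
    the smaller index first lowers the position of the larger one by one, which
    flips the sign. *)
Lemma cech_diff_sqr c : cech_diff (cech_diff c) = 0.
Proof.
apply/ffunP=> J; rewrite ffunE [RHS]ffunE.
(* Writing the components of c as fractions gives all terms one common type,
   so that the two orders of removal can be compared. *)
pose m K := (repr (c K)).1; pose k K := (repr (c K)).2.
pose s (K : {set 'I_r}) (i : 'I_r) := #|[pred j in K | (j < i)%N]|.
pose term i j := let K := J :\ i :\ j in
  frac (set_prod a J) (((a i * a j) ^+ k K) *: m K) (k K).
pose T i j := (-1) ^+ (s J i + s (J :\ i) j) *: term i j.
have termC i j : term i j = term j i.
  rewrite /term (_ : J :\ i :\ j = J :\ j :\ i) 1?mulrC //.
  by apply/setP=> l; rewrite !inE andbCA.
transitivity (\sum_(i in J) \sum_(j in J :\ i) T i j).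
  apply: eq_bigr => i iJ; rewrite ffunE.
  pose L : {linear loc N (set_prod a (J :\ i)) -> loc N (set_prod a J)} :=
    HB.pack (@loc_res A N (set_prod a (J :\ i)) (a i) (set_prod a J))
      (GRing.isLinear.Build _ _ _ _ _ (loc_res_linear (set_prodD1 a iJ))).
  rewrite -[loc_res _ _ _]/(L _) linear_sum scaler_sumr.
  apply: eq_bigr => j jJ; rewrite linearZ scalerA -exprD; congr (_ *: _).
  rewrite -[c (_ :\ j)]fracE (loc_resE (set_prodD1 a jJ)) /=.
  by rewrite (loc_resE (set_prodD1 a iJ)) scalerA -exprMn.
have sJ (i j : 'I_r) : (j < i)%N -> s (J :\ i) j = s J j.
  move=> ji; apply: eq_card => l; rewrite !inE.
  by case: eqP => [->|_] //; rewrite ltnNge (ltnW ji) !andbF.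
have sJ' (i j : 'I_r) : j \in J -> (j < i)%N -> s J i = (s (J :\ j) i).+1.
  move=> jJ ji; rewrite /s (cardD1 j) !inE jJ ji add1n; congr _.+1.
  by apply: eq_card => l; rewrite !inE andbA.
have splitT i : i \in J -> \sum_(j in J :\ i) T i j =
    \sum_(j in J | (j < i)%N) T i j + \sum_(j in J | (i < j)%N) T i j.
  move=> iJ; rewrite (bigID (fun j : 'I_r => (j < i)%N)) /=; congr (_ + _).
    apply: eq_bigl => j; rewrite !inE; case: eqP => [->|_] //=.
    by rewrite ltnn andbF.
  apply: eq_bigl => j; rewrite !inE -val_eqE /= -leqNgt ltn_neqAle eq_sym.
  by rewrite -andbA andbCA.
rewrite (eq_bigr _ splitT) big_split /=.
rewrite [X in _ + X](exchange_big_dep (mem J)) /=; last by move=> i j _ /andP[].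
rewrite -big_split big1 //= => i iJ.
under [X in _ + X]eq_bigl => j do rewrite iJ.
rewrite -big_split big1 //= => j /andP[jJ ji].
rewrite /T (termC j i) -scalerDl sJ // (sJ' i j) //.
by rewrite addSn exprS mulN1r addnC addNr scale0r.
Qed.

(** Cochains of degree p - 1; for p = 0 only the zero cochain, in accordance
    with the definition of coboundaries. *)
Definition cochain_pred p b := forall J : {set 'I_r}, #|J|.+1 <> p -> b J = 0.

Definition bounds p c := exists2 b, cochain_pred p b & c = cech_diff b.

Definition acyclic p :=
  forall c, cochain p c -> cech_diff c = 0 -> bounds p c.

Lemma acyclicP p : acyclic p <-> forall x : cohomology a N p, x = 0.
Proof.
split=> [ac x|h c c1 c2].
  rewrite -[x]coho_class_repr; have /asboolP[z1 z2] := valP (repr x).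
  have [b b1 b2] := ac _ z1 z2.
  have -> : 0 = coho_class (0 : cocycles a N p).
    rewrite -[RHS]addr0 -{2}(subrr (coho_class 0)) addrA -coho_classD.
    by rewrite addr0 subrr.
  by apply/coho_classP; rewrite subr0; apply/asboolP; exists b.
have z : cocycle p c by apply/asboolP.
pose zc : cocycles a N p := exist _ c z.
have /coho_classP : coho_class zc = coho_class 0.
  by rewrite (h (coho_class zc)) (h (coho_class 0)).
by rewrite subr0 => /asboolP[b b1 b2]; exists b.
Qed.

Lemma cochain_predD p b b' :
  cochain_pred p b -> cochain_pred p b' -> cochain_pred p (b + b').
Proof. by move=> h h' J pJ; rewrite ffunE h ?h' ?addr0. Qed.

Lemma cochain_predN p b : cochain_pred p b -> cochain_pred p (- b).
Proof. by move=> h J pJ; rewrite ffunE h ?oppr0. Qed.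

Lemma cochain_pred_diff p b : cochain_pred p b -> cochain p (cech_diff b).
Proof.
move=> h J pJ; rewrite ffunE big1 // => i iJ; rewrite h; last first.
  by rewrite (cardsD1 i) iJ add1n in pJ.
by rewrite -(frac0 _ _ 0) (loc_resE (set_prodD1 a iJ)) scaler0 frac0 scaler0.
Qed.

Lemma bounds0 p : bounds p 0.
Proof. by exists 0; [move=> J _; rewrite ffunE|rewrite linear0]. Qed.

Lemma boundsD p c c' : bounds p c -> bounds p c' -> bounds p (c + c').
Proof.
move=> [b b1 ->] [b' b1' ->]; exists (b + b'); last by rewrite linearD.
exact: cochain_predD.
Qed.

Lemma bounds_sum p (T : Type) (s : seq T) (P : pred T) F :
  (forall t, P t -> bounds p (F t)) -> bounds p (\sum_(t <- s | P t) F t).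
Proof. by move=> h; apply: big_ind => //; [exact: bounds0|exact: boundsD]. Qed.

End CechComplex.

(** * Vanishing of cohomology: sums, colimits and the staircase *)

Section Functoriality.
Variables (A : comPzRingType) (r : nat) (a : 'I_r -> A).
Implicit Types (N : lmodType A).

Lemma cech_map_cochain N N' (g : {linear N -> N'}) p (c : cech a N) :
  cochain p c -> cochain p (cech_map g c).
Proof. by move=> h J pJ; rewrite ffunE h ?linear0. Qed.

Lemma cech_map_cochain_pred N N' (g : {linear N -> N'}) p (c : cech a N) :
  cochain_pred p c -> cochain_pred p (cech_map g c).
Proof. by move=> h J pJ; rewrite ffunE h ?linear0. Qed.

Lemma cech_map_bounds N N' (g : {linear N -> N'}) p (c : cech a N) :
  bounds p c -> bounds p (cech_map g c).
Proof.
move=> [b b1 ->]; exists (cech_map g b); last by rewrite cech_map_diff.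
exact: cech_map_cochain_pred.
Qed.

Lemma acyclic_zero N p : (forall x : N, x = 0) -> acyclic a N p.
Proof.
move=> N0 c _ _; rewrite (_ : c = 0); first exact: bounds0.
apply/ffunP=> K; rewrite ffunE; elim/frac_ind: (c K) => m k.
by rewrite (N0 m) frac0.
Qed.

(** Cech cohomology is additive: a cocycle is the sum of its projections, and
    each of these is a coboundary. *)
Lemma acyclic_sum N (T : finType) (N_ : T -> lmodType A) p
    (pr : forall t, {linear N -> N_ t}) (inj : forall t, {linear N_ t -> N}) :
  (forall x, \sum_t inj t (pr t x) = x) ->
  (forall t, acyclic a (N_ t) p) -> acyclic a N p.
Proof.
move=> dec ac c c1 c2.
have -> : c = \sum_t cech_map (inj t \o pr t) c.
  by rewrite -cech_map_sum -{1}[c]cech_map_id; apply: cech_map_eq => x /=.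
apply: bounds_sum => t _; rewrite cech_map_comp; apply: cech_map_bounds.
apply: ac => //; first exact: cech_map_cochain.
by rewrite cech_map_diff c2 linear0.
Qed.

(** Cech cohomology commutes with sequential colimits. The two hypotheses say
    that N is the colimit of the G l for families indexed by the subsets of 'I_r,
    which is what a cochain consists of; the second one also provides a stage
    whose cohomology vanishes. A cocycle lifts to a cochain at some stage, its
    differential dies at a later one, and there it is a coboundary. *)
Lemma acyclic_colim N (G : nat -> lmodType A) p
    (phi : forall l, {linear G l -> N}) :
  (forall v : {set 'I_r} -> N, exists l (g : {set 'I_r} -> G l),
     forall K, phi l (g K) = v K) ->
  (forall l (w : {set 'I_r} -> G l), (forall K, phi l (w K) = 0) ->
     exists l' (tau : {linear G l -> G l'}),
     [/\ forall x, phi l' (tau x) = phi l x, forall K, tau (w K) = 0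
       & acyclic a (G l') p]) ->
  acyclic a N p.
Proof.
move=> lift kill c c1 c2.
have [l [g gP]] := lift (fun K => (repr (c K)).1).
pose c0 : cech a (G l) :=
  [ffun K : {set 'I_r} =>
    if #|K| == p then frac (set_prod a K) (g K) (repr (c K)).2 else 0].
have c0E : cech_map (phi l) c0 = c.
  apply/ffunP=> K; rewrite !ffunE.
  case: eqP => [_|/c1->]; last by rewrite linear0.
  by rewrite loc_mapE gP fracE.
have phiD K : exists x, phi l x = 0 /\ exists k, cech_diff c0 K = frac _ x k.
  have : loc_map (phi l) (cech_diff c0 K) = 0.
    have := cech_map_diff (phi l) c0; rewrite c0E c2 => /ffunP/(_ K).
    by rewrite [LHS]ffunE [RHS]ffunE => <-.
  elim/frac_ind: (cech_diff c0 K) => m k; rewrite loc_mapE.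
  rewrite -(frac0 _ _ 0) => /fracP[s].
  rewrite scale1r !scaler0 -linearZ => e.
  exists (set_prod a K ^+ s *: m); split=> //.
  by exists (s + k)%N; rewrite frac_mul.
pose w K := sval (cid (phiD K)); have wP K := svalP (cid (phiD K)).
have [|l' [tau [tau1 tau2 ac]]] := kill l w; first by move=> K; case: (wP K).
have -> : c = cech_map (phi l') (cech_map tau c0).
  by rewrite -cech_map_comp -{1}c0E; apply: cech_map_eq => x /=.
apply: cech_map_bounds; apply: ac.
  by apply: cech_map_cochain => K /eqP/negPf pK; rewrite ffunE pK.
rewrite cech_map_diff; apply/ffunP=> K; rewrite [LHS]ffunE [RHS]ffunE.
have [_ [k ->]] := wP K; rewrite loc_mapE.
by have := tau2 K; rewrite /w => ->; rewrite frac0.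
Qed.

(** One side of the staircase in the double complex with rows the Cech complexes
    of the G q: if the coboundary of b is killed by delta then b can be corrected
    by a coboundary so that delta kills b itself. Indeed delta b is a cocycle,
    hence a coboundary, and by induction has a primitive killed by delta; this
    primitive lifts along delta by exactness, and the coboundary of the lift is
    the correction. *)
Lemma acyclic_lift_primitive (G : nat -> lmodType A)
    (delta : forall q, {linear G q -> G q.+1})
    (delta_sqr : forall q x, delta q.+1 (delta q x) = 0) e p :
  (forall i q, (i < p)%N -> acyclic a (G q) i) ->
  (forall j, (j.+1 < e)%N -> forall x : G j.+1, delta j.+1 x = 0 ->
     exists w, delta j w = x) ->
  forall q, (q + p <= e)%N -> forall b : cech a (G q), cochain_pred p b ->
    cech_map (delta q) (cech_diff b) = 0 ->
  exists b', [/\ cochain_pred p b', cech_diff b' = cech_diff b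
                & cech_map (delta q) b' = 0].
Proof.
move=> + ex; elim: p => [|p IHp] ac q qp b b1 b2.
  have b0 : b = 0 by apply/ffunP=> J; rewrite b1 // ffunE.
  by exists b; split=> //; rewrite b0 linear0.
have delta2 : cech_map (delta q.+1) (cech_map (delta q) b) = 0.
  rewrite -cech_map_comp.
  by apply: cech_map0 => x; apply: delta_sqr.
have coc : cochain p (cech_map (delta q) b).
  by apply: cech_map_cochain => J pJ; apply: b1 => -[].
have [|b' b'1 b'2] := ac p q.+1 (ltnSn p) _ coc; first by rewrite cech_map_diff.
have [|||b'' [b''1 b''2 b''3]] := IHp _ q.+1 _ b' b'1.
- by move=> i j ip; apply: ac; lia.
- by lia.
- by rewrite -b'2.
have [w w1 w2] : exists2 w, cech_map (delta q) w = b'' & cochain_pred p w.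
  case: (posnP p) => [p0|p_gt0].
    exists 0; last by move=> J _; rewrite ffunE.
    by rewrite linear0; apply/ffunP=> J; rewrite b''1 ?p0 // ffunE.
  have [|//|w w1 w2] := cech_map_exact (u := delta q) (v := delta q.+1) (c := b'').
    by apply: ex; lia.
  by exists w => // J pJ; rewrite w2 // b''1.
exists (b - cech_diff w); split.
- apply: cochain_predD => //; apply: cochain_predN => J pJ.
  apply: (cochain_pred_diff w2); lia.
- by rewrite linearB /= cech_diff_sqr subr0.
- by rewrite linearB /= -cech_map_diff w1 b''2 -b'2 subrr.
Qed.

(** Comparison of the two spectral sequences of the double complex, reduced to
    the corner that matters: where the columns are exact and the rows have no
    cohomology below degree p, the map induced by delta0 on the cohomology of
    degree p is injective. *)
Lemma staircase (M0 : lmodType A) (G : nat -> lmodType A)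
    (delta0 : {linear M0 -> G 0%N}) (delta : forall q, {linear G q -> G q.+1})
    (delta0_sqr : forall x, delta 0%N (delta0 x) = 0)
    (delta_sqr : forall q x, delta q.+1 (delta q x) = 0) p :
  (forall i q, (i < p)%N -> acyclic a (G q) i) ->
  (forall x, delta0 x = 0 -> x = 0) ->
  ((0 < p)%N -> forall x, delta 0%N x = 0 -> exists w, delta0 w = x) ->
  (forall j, (j.+1 < p)%N -> forall x : G j.+1, delta j.+1 x = 0 ->
     exists w, delta j w = x) ->
  forall c : cech a M0, cochain p c -> bounds p (cech_map delta0 c) ->
  bounds p c.
Proof.
move=> ac inj ex0 ex c c1 [b b1 b2].
have [] := @acyclic_lift_primitive G delta delta_sqr p p ac ex 0%N _ b b1.
- by [].
- rewrite -b2 -cech_map_comp.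
  by apply: cech_map0 => x; apply: delta0_sqr.
move=> b' [b'1 b'2 b'3].
have [w w1 w2] : exists2 w, cech_map delta0 w = b' & cochain_pred p w.
  case: (posnP p) => [p0|p_gt0].
    exists 0; last by move=> J _; rewrite ffunE.
    by rewrite linear0; apply/ffunP=> J; rewrite b'1 ?p0 // ffunE.
  have [|//|w w1 w2] := cech_map_exact (u := delta0) (v := delta 0%N) (c := b').
    exact: ex0.
  by exists w => // J pJ; rewrite w2 // b'1.
exists w => //; apply/eqP; rewrite -subr_eq0; apply/eqP.
apply: (cech_map_inj inj).
by rewrite linearB /= -cech_map_diff w1 b'2 b2 subrr.
Qed.

End Functoriality.

(** * Depth and vanishing *)

Section Depth.
Variables (A : comPzRingType) (r : nat) (a : 'I_r -> A) (N : lmodType A).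

(** The depth satisfies the description that defines it: when some cohomology
    module is nonzero the maximum is the least degree of such a module, and
    otherwise it is +oo. *)
Lemma depth_max :
  let D := [set p : \bar int |
    (p = +oo%E \/ exists n : nat, p = (n%:Z)%:E) /\
    forall i : nat, ((i%:Z)%:E < p)%E -> forall x : cohomology a N i, x = 0] in
  D (depth a N) /\ ubound D (depth a N).
Proof.
move=> D; suff [p pD] : exists p, (D `&` ubound D) p.
  by rewrite /depth; case: xgetP => [_ -> []//|/(_ p)].
case: (pselect (forall i, acyclic a N i)) => [all|/existsNP[i0 i0P]].
  exists +oo%E; split=> [|x _]; last exact: leey.
  by split; [left|move=> i _; apply/acyclicP].
have ex : exists i, `[< ~ acyclic a N i >] by exists i0; apply/asboolP.
case: (ex_minnP ex) => n /asboolP nP min; exists (n%:Z)%:E; split.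
  split; first by right; exists n.
  move=> i; rewrite lte_fin => lin; apply/acyclicP; apply: contrapT => /asboolP.
  by move/min; lia.
move=> x [_ xP]; rewrite leNgt; apply/negP => /xP h.
by apply: nP; apply/acyclicP.
Qed.

Lemma depth_geP (n : nat) :
  (n%:Z%:E <= depth a N)%E <-> forall i, (i < n)%N -> acyclic a N i.
Proof.
have [[_ dP] dub] := depth_max; split=> [nd i lin|h].
  by apply/acyclicP/dP; apply: lt_le_trans nd; rewrite lte_fin; lia.
apply: dub; split; first by right; exists n.
by move=> i; rewrite lte_fin => lin; apply/acyclicP/h; lia.
Qed.

End Depth.

(** * Homogeneous components *)

Section DirectSum.
Variables (I : eqType) (V : zmodType) (W : I -> set V).
Hypothesis W_direct : direct_sum W.

Let W0 i : W i 0. Proof. by have [h _ _] := W_direct; case: (h i). Qed.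
Let WB i x y : W i x -> W i y -> W i (x - y).
Proof. by have [h _ _] := W_direct; case: (h i) => _; apply. Qed.

(** Unlike in the definition of a direct sum, c is required to vanish outside
    s; this makes c unique and independent of s. *)
Definition decomposition (x : V) (s : seq I) (c : I -> V) :=
  [/\ uniq s, forall i, W i (c i), forall i, i \notin s -> c i = 0
    & x = \sum_(i <- s) c i].

Lemma decomposition_ex x : exists p : seq I * (I -> V), decomposition x p.1 p.2.
Proof.
have [_ /(_ x)[s [c [us cW xE]]] _] := W_direct.
exists (s, fun i => if i \in s then c i else 0); split=> //=.
- by move=> i; case: ifP.
- by move=> i /negPf->.
- by rewrite xE; apply: eq_big_seq => i ->.
Qed.

Definition hproj (i : I) (x : V) : V := (sval (cid (decomposition_ex x))).2 i.

Lemma decomposition_widen x s c t : decomposition x s c -> uniq t ->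
  {subset s <= t} -> x = \sum_(i <- t) c i.
Proof.
move=> [us _ c0 ->] ut st.
rewrite [RHS](bigID (mem s)) /= [X in _ + X]big1 ?addr0 //.
rewrite -[RHS]big_filter; apply: perm_big; apply: uniq_perm => //.
  exact: filter_uniq.
move=> i; rewrite mem_filter /=; case: (boolP (i \in s)) => [/st->|] //.
Qed.

(** Uniqueness of decompositions: both are extended to a common index sequence,
    where their difference is a vanishing sum. *)
Lemma hprojE x s c i : decomposition x s c -> hproj i x = c i.
Proof.
move=> dec; rewrite /hproj; case: (cid _) => -[s' c'] /= dec'.
have [_ _ indep] := W_direct.
pose t := undup (s ++ s').
have [[_ cW c0 _] [_ cW' c0' _]] := (dec, dec').
have e : \sum_(j <- t) (c' j - c j) = 0.
  rewrite sumrB -(decomposition_widen dec) ?undup_uniq //; last first.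
    by move=> j; rewrite mem_undup mem_cat => ->.
  rewrite -(decomposition_widen dec') ?undup_uniq ?subrr // => j.
  by rewrite mem_undup mem_cat orbC => ->.
case: (boolP (i \in t)) => [it|]; last first.
  by rewrite mem_undup mem_cat negb_or => /andP[/c0-> /c0'->].
apply/eqP; rewrite -subr_eq0; apply/eqP; move: i it.
by apply: indep e; [exact: undup_uniq|move=> j; apply: WB].
Qed.

Lemma hproj_dec x : decomposition x (sval (cid (decomposition_ex x))).1 (hproj^~ x).
Proof. exact: (svalP (cid (decomposition_ex x))). Qed.

Lemma hproj_in i x : W i (hproj i x).
Proof. by have [] := hproj_dec x. Qed.

Lemma hproj_id i x : W i x -> hproj i x = x.
Proof.
move=> Wx; rewrite (@hprojE _ [:: i] (fun j => if j == i then x else 0)) ?eqxx //.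
split=> //; first by move=> j; case: eqP => [->|].
  by move=> j; rewrite inE => /negPf->.
by rewrite big_seq1 eqxx.
Qed.

Lemma hproj_ne i j x : W j x -> i != j -> hproj i x = 0.
Proof.
move=> Wx /negPf ij.
rewrite (@hprojE _ [:: j] (fun k => if k == j then x else 0)) ?ij //.
split=> //; first by move=> k; case: eqP => [->|].
  by move=> k; rewrite inE => /negPf->.
by rewrite big_seq1 eqxx.
Qed.

Lemma hproj_is_additive i : zmod_morphism (hproj i).
Proof.
move=> x y; have [[us xW x0 xE] [us' yW y0 yE]] := (hproj_dec x, hproj_dec y).
set s := (sval _).1 in us x0 xE; set s' := (sval _).1 in us' y0 yE.
pose t := undup (s ++ s').
rewrite (@hprojE _ t (fun j => hproj j x - hproj j y)) //; split.
- exact: undup_uniq.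
- by move=> j; apply: WB; apply: hproj_in.
- move=> j; rewrite mem_undup mem_cat negb_or => /andP[/x0-> /y0->].
  by rewrite subr0.
rewrite sumrB; congr (_ - _).
  apply: (decomposition_widen (hproj_dec x)); first exact: undup_uniq.
  by move=> j; rewrite mem_undup mem_cat -/s => ->.
apply: (decomposition_widen (hproj_dec y)); first exact: undup_uniq.
by move=> j; rewrite mem_undup mem_cat -/s' orbC => ->.
Qed.

HB.instance Definition _ i :=
  GRing.isZmodMorphism.Build V V (hproj i) (hproj_is_additive i).

(** Multiplication by a homogeneous element permutes the degrees, so it maps
    the decomposition of x to one of u x. *)
Lemma hproj_shift (u : {additive V -> V}) (h h' : I -> I) i x :
  cancel h h' -> cancel h' h -> (forall j z, W j z -> W (h j) (u z)) ->
  hproj (h i) (u x) = u (hproj i x).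
Proof.
move=> hK hK' uW; have [us xW x0 xE] := hproj_dec x.
set s := (sval _).1 in us x0 xE.
rewrite (@hprojE _ (map h s) (fun j => u (hproj (h' j) x))) ?hK //; split.
- by rewrite map_inj_uniq //; apply: can_inj hK.
- by move=> j; rewrite -{1}[j]hK'; apply: uW.
- move=> j js; rewrite x0 ?raddf0 //; apply: contra js => js.
  by rewrite -[j]hK' map_f.
by rewrite big_map {1}xE raddf_sum; apply: eq_bigr => j _; rewrite hK.
Qed.

End DirectSum.

(** * Standard graded algebras *)

Section GradedAlgebra.
Variables (R S : comPzRingType) (gS : standardGradedAlgebra R S).
Local Notation part := (alg_part gS).

Lemma alg_part_1 : part 0%N 1.
Proof. by rewrite alg_part0; exists 1; rewrite ?rmorph1. Qed.

Lemma alg_part_0 k : part k 0.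
Proof. by have [h _ _] := alg_part_direct gS; case: (h k). Qed.

Lemma alg_partB k s t : part k s -> part k t -> part k (s - t).
Proof. by have [h _ _] := alg_part_direct gS; case: (h k) => _; apply. Qed.

Lemma alg_partD k s t : part k s -> part k t -> part k (s + t).
Proof.
move=> sk tk; rewrite -[t]opprK; apply: alg_partB => //.
by rewrite -sub0r; apply: alg_partB => //; apply: alg_part_0.
Qed.

Lemma alg_partX k s l : part k s -> part (l * k) (s ^+ l).
Proof.
move=> sk; elim: l => [|l IHl]; first by rewrite expr0 mul0n; apply: alg_part_1.
by rewrite exprS mulSn; apply: alg_partM.
Qed.

Lemma alg_part_prod (T : finType) (J : {set T}) (y : T -> S) (e : T -> nat) :
  (forall i, part (e i) (y i)) -> part (\sum_(i in J) e i) (\prod_(i in J) y i).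
Proof.
move=> h; apply: (big_ind2 (fun k s => part k s)) => //; first exact: alg_part_1.
by move=> *; apply: alg_partM.
Qed.

(** Only one factor of degree 1 is split off, instead of a decomposition into
    monomials: this is the form needed for an induction on the degree, and it is
    stable under products. *)
Definition generated_part k (u : S) : Prop :=
  if k is k'.+1 then exists l : seq (S * S),
    (forall x, x \in l -> part 1 x.1 /\ part k' x.2) /\
    u = \sum_(x <- l) x.1 * x.2
  else part 0%N u.

Lemma alg_part_sum k (T : eqType) (l : seq T) F :
  (forall x, x \in l -> part k (F x)) -> part k (\sum_(x <- l) F x).
Proof.
move=> h; rewrite big_seq; apply: big_ind => //; first exact: alg_part_0.
exact: alg_partD.
Qed.

Lemma generated_part_sub k u : generated_part k u -> part k u.
Proof.
case: k => [|k] //= -[l [lP ->]]; apply: alg_part_sum => x /lP[x1 x2].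
by rewrite -add1n; apply: alg_partM.
Qed.

Lemma generated_partM i j u v :
  generated_part i u -> generated_part j v -> generated_part (i + j) (u * v).
Proof.
have mulS i' j' u' v' : generated_part i'.+1 u' -> part j' v' ->
    generated_part (i'.+1 + j') (u' * v').
  move=> [l [lP ->]] vj; exists [seq (x.1, x.2 * v') | x <- l]; split.
    by move=> _ /mapP[x /lP[x1 x2] ->] /=; split=> //; apply: alg_partM.
  by rewrite mulr_suml big_map; apply: eq_bigr => x _; rewrite mulrA.
case: i j => [|i] [|j] hu hv.
- exact: (alg_partM hu hv).
- by rewrite addnC mulrC; apply: mulS.
- exact: mulS.
- by apply: mulS => //; apply: generated_part_sub.
Qed.

Lemma generated_part0 k : generated_part k 0.
Proof.
case: k => [|k]; first exact: alg_part_0.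
by exists [::]; split=> //; rewrite big_nil.
Qed.

Lemma generated_partD k u v :
  generated_part k u -> generated_part k v -> generated_part k (u + v).
Proof.
case: k => [|k]; first exact: alg_partD.
move=> [l [lP ->]] [l' [lP' ->]]; exists (l ++ l'); split; last by rewrite big_cat.
by move=> x; rewrite mem_cat => /orP[/lP|/lP'].
Qed.

(** The sums of elements of the generated parts form a subalgebra that contains
    the scalars and the given generators. *)
Lemma generated_part_all s : exists l : seq (nat * S),
  (forall x, x \in l -> generated_part x.1 x.2) /\ s = \sum_(x <- l) x.2.
Proof.
have [n [x [x1 gen]]] := alg_part1_gen gS.
set T := [set s | exists l : seq (nat * S),
  (forall x, x \in l -> generated_part x.1 x.2) /\ s = \sum_(x <- l) x.2].
suff : setT `<=` T by move=> /(_ s I).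
rewrite -gen; apply: smallest_sub; last first.
  move=> _ [i _ <-]; exists [:: (1%N, x i)]; split; last by rewrite big_seq1.
  move=> _ /[1!inE] /eqP-> /=; exists [:: (x i, 1)]; rewrite big_seq1 mulr1.
  by split=> // _ /[1!inE] /eqP-> /=; split=> //; apply: alg_part_1.
split.
- move=> _ [t _ <-]; exists [:: (0%N, scal gS t)]; rewrite big_seq1; split=> //.
  by move=> _ /[1!inE] /eqP-> /=; rewrite alg_part0; exists t.
- move=> u v [l [lP ->]] [l' [lP' ->]]; exists (l ++ l'); rewrite big_cat.
  by split=> // z; rewrite mem_cat => /orP[/lP|/lP'].
move=> u v [l [lP ->]] [l' [lP' ->]].
exists [seq ((z.1 + z'.1)%N, z.2 * z'.2) | z <- l, z' <- l']; split.
  move=> _ /allpairsP[[z z'] /= [/lP zl /lP' zl' ->]] /=.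
  exact: generated_partM.
rewrite big_allpairs_dep mulr_suml; apply: eq_bigr => z _.
by rewrite mulr_sumr.
Qed.

(** The products of an element of degree 1 and one of degree k generate the part
    of degree k + 1 additively: this is what standard graded means here. *)
Lemma alg_part_succ_ind k (P : S -> Prop) :
  P 0 -> (forall s t, P s -> P t -> P (s + t)) ->
  (forall s t, part 1 s -> part k t -> P (s * t)) ->
  forall u, part k.+1 u -> P u.
Proof.
move=> P0 PD PM u uk.
have gen : generated_part k.+1 u.
  rewrite -(hproj_id (alg_part_direct gS) uk).
  have [l [lP ->]] := generated_part_all u.
  rewrite raddf_sum big_seq; apply: big_ind => [||x /lP].
  - exact: generated_part0.
  - exact: generated_partD.
  case: x => j v /= vj; have [jk|jk] := eqVneq k.+1 j.
    by rewrite -jk in vj *; rewrite hproj_id //; apply: generated_part_sub.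
  rewrite (hproj_ne _ (generated_part_sub vj)) //.
  exact: (generated_part0 k.+1).
case: gen => l [lP ->]; rewrite big_seq; apply: big_ind => // x /lP[]; exact: PM.
Qed.

(** The elements of S_+ have no component of degree 0. Hence a generator of S_+
    to which the degree 0 is assigned is zero, and so is any localization at it. *)
Lemma irrelevant_part0 s : irrelevant_ideal gS s -> part 0%N s -> s = 0.
Proof.
move=> [n [c [cP ->]]] s0; rewrite -(hproj_id (alg_part_direct gS) s0) raddf_sum.
rewrite big_nat big1 //= => i /andP[i1 _].
by rewrite (hproj_ne _ (cP i)) // eq_sym -lt0n.
Qed.

End GradedAlgebra.

(** * Restriction of scalars to homogeneous pieces *)

Section RestrictedSubmodule.
Variables (R S : comPzRingType) (phi : {rmorphism R -> S}) (Q : lmodType S).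
Variable P : zmodClosed Q.

(** An additive subgroup of an S-module that is stable under R is an R-module.
    The pieces of fixed degree are not S-modules, but they are of this form. *)
Definition rsubmod of (forall t x, x \in P -> phi t *: x \in P) := {x | x \in P}.

Variable PZ : forall t x, x \in P -> phi t *: x \in P.
Local Notation X := (rsubmod PZ).

HB.instance Definition _ := SubChoice.on X.
HB.instance Definition _ := [SubChoice_isSubZmodule of X by <:].

Definition rsubmod_scale (t : R) (x : X) : X :=
  exist (fun x => x \in P) _ (PZ t (valP x)).

Lemma rsubmod_scaleA s t x :
  rsubmod_scale s (rsubmod_scale t x) = rsubmod_scale (s * t) x.
Proof. by apply: val_inj; rewrite /= scalerA rmorphM. Qed.
Lemma rsubmod_scale1 : left_id 1 rsubmod_scale.
Proof. by move=> x; apply: val_inj; rewrite /= rmorph1 scale1r. Qed.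
Lemma rsubmod_scaleDr : right_distributive rsubmod_scale +%R.
Proof. by move=> s x y; apply: val_inj; rewrite /= -scalerDr. Qed.
Lemma rsubmod_scaleDl x : {morph rsubmod_scale^~ x : s t / s + t}.
Proof. by move=> s t; apply: val_inj; rewrite /= rmorphD scalerDl. Qed.

HB.instance Definition _ := GRing.Zmodule_isLmodule.Build R X
  rsubmod_scaleA rsubmod_scale1 rsubmod_scaleDr rsubmod_scaleDl.

End RestrictedSubmodule.

Section Embeddings.
Variables (R S : comPzRingType) (phi : {rmorphism R -> S}).

(** An R-module realized as a subgroup of an S-module. All maps between
    homogeneous pieces are restrictions of S-linear maps, so they are obtained
    from such realizations by lift_linear. *)
Definition semi_embedding (X : lmodType R) (Q : lmodType S) (v : X -> Q) :=
  [/\ injective v, {morph v : x y / x + y}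
    & forall t x, v (t *: x) = phi t *: v x].

Lemma rsubmod_embedding (Q : lmodType S) (P : zmodClosed Q) PZ :
  semi_embedding (fun x : @rsubmod R S phi Q P PZ => val x).
Proof. by split=> //; exact: val_inj. Qed.

Lemma lift_linear (X Y : lmodType R) (Q Q' : lmodType S)
    (v : X -> Q) (w : Y -> Q') (u : {linear Q -> Q'}) :
  semi_embedding v -> semi_embedding w ->
  (forall x, exists y, w y = u (v x)) ->
  exists g : {linear X -> Y}, forall x, w (g x) = u (v x).
Proof.
move=> [_ vD vZ] [wI wD wZ] ex.
pose g x := sval (cid (ex x)).
have gP x : w (g x) = u (v x) by exact: (svalP (cid (ex x))).
have g_lin : linear g.
  by move=> t x y; apply: wI; rewrite wD wZ !gP vD vZ linearD (linearZ_LR u).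
pose L : {linear X -> Y} := HB.pack g (GRing.isLinear.Build _ _ _ _ g g_lin).
by exists L.
Qed.

End Embeddings.

(** * Homogeneous pieces of localizations *)

Section GradedLoc.
Variables (R S : comPzRingType) (gS : standardGradedAlgebra R S).
Variables (M : lmodType S) (gM : gradedModule gS M).
Implicit Types (mu nu : int).

Lemma mod_partB mu m m' :
  mod_part gM mu m -> mod_part gM mu m' -> mod_part gM mu (m - m').
Proof. by have [h _ _] := mod_part_direct gM; case: (h mu) => _; apply. Qed.

Lemma mod_part_0 mu : mod_part gM mu 0.
Proof. by have [h _ _] := mod_part_direct gM; case: (h mu). Qed.

Definition comp_val mu (m : component gM mu) : M := val m.

Lemma comp_embedding mu : semi_embedding (scal gS) (@comp_val mu).
Proof. by split=> //; exact: val_inj. Qed.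

Lemma comp_valP mu (m : component gM mu) : mod_part gM mu (comp_val m).
Proof. exact/asboolP/(valP m). Qed.

Lemma compP mu m : mod_part gM mu m -> exists x : component gM mu, comp_val x = m.
Proof. by move=> /asboolP h; exists (exist _ m h). Qed.

(** The target degree is a separate variable with an equation, because the sums
    of degrees that occur are equal but not convertible. *)
Lemma comp_mul mu nu k s : alg_part gS k s -> k%:Z + mu = nu ->
  exists g : {linear component gM mu -> component gM nu},
    forall m, comp_val (g m) = s *: comp_val m.
Proof.
move=> sk <-.
have s_lin : linear ( *:%R s : M -> M).
  by move=> t x y; rewrite scalerDr !scalerA mulrC.
pose u : {linear M -> M} := HB.pack ( *:%R s : M -> M)
  (GRing.isLinear.Build _ _ _ _ _ s_lin).
apply: (lift_linear (u := u) (comp_embedding mu) (comp_embedding _)) => m.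
exact/compP/mod_partZ/comp_valP.
Qed.

Section Piece.
Variables (f : S) (eps : nat) (mu : int).
Hypothesis f_eps : alg_part gS eps f.

Definition loc_part : set (loc M f) := [set z | exists (m : M) (k : nat),
  mod_part gM (mu + (k * eps)%N%:Z) m /\ z = frac f m k].

Lemma mod_partX k l m : mod_part gM (mu + (k * eps)%N%:Z) m ->
  mod_part gM (mu + ((l + k) * eps)%N%:Z) (f ^+ l *: m).
Proof.
move=> mk.
rewrite (_ : _ + _ = (l * eps)%N%:Z + (mu + (k * eps)%N%:Z)); last by lia.
by apply: mod_partZ => //; apply: alg_partX.
Qed.

Lemma loc_partB z w : loc_part z -> loc_part w -> loc_part (z - w).
Proof.
move=> [m [k [mk ->]]] [m' [k' [mk' ->]]].
exists (f ^+ k' *: m - f ^+ k *: m'), (k + k')%N; split; last first.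
  rewrite (_ : - frac f m' k' = frac f (- m') k') ?fracD ?scalerN //.
  exact: loc_oppE.
by apply: mod_partB; [rewrite addnC|]; apply: mod_partX.
Qed.

Lemma loc_part_0 : loc_part 0.
Proof. by exists 0, 0%N; rewrite frac0; split=> //; apply: mod_part_0. Qed.

Lemma loc_partZ t z : loc_part z -> loc_part (scal gS t *: z).
Proof.
move=> [m [k [mk ->]]]; exists (scal gS t *: m), k; rewrite fracZ; split=> //.
rewrite -[X in mod_part _ X _]add0r; apply: (mod_partZ (i := 0%N)) => //.
by rewrite alg_part0; exists t.
Qed.

Definition loc_part_pred : {pred loc M f} := fun z => `[< loc_part z >].

Lemma loc_part_pred_closed : zmod_closed loc_part_pred.
Proof.
split=> [|z w /asboolP hz /asboolP hw]; apply/asboolP; first exact: loc_part_0.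
exact: loc_partB.
Qed.

Definition loc_part_zmod : zmodClosed (loc M f) :=
  HB.pack loc_part_pred (GRing.isZmodClosed.Build _ _ loc_part_pred_closed).

Lemma loc_part_zmodZ t z :
  z \in loc_part_zmod -> scal gS t *: z \in loc_part_zmod.
Proof. by move=> /asboolP h; apply/asboolP/loc_partZ. Qed.

Definition loc_piece := rsubmod loc_part_zmodZ.

(** The projection of a localization onto its part of degree mu, computed on
    numerators; loc_projE says that it does not depend on the fraction. *)
Definition loc_proj (z : loc M f) : loc M f :=
  frac f (hproj (mod_part_direct gM) (mu + ((repr z).2 * eps)%N%:Z) (repr z).1)
    (repr z).2.

Lemma hprojZ k s nu m : alg_part gS k s ->
  hproj (mod_part_direct gM) (k%:Z + nu) (s *: m)
  = s *: hproj (mod_part_direct gM) nu m.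
Proof.
move=> sk.
apply: (@hproj_shift _ _ _ _ ( *:%R s) (+%R k%:Z) (fun j => j - k%:Z)).
- by move=> i; rewrite addrC addKr.
- by move=> i; rewrite addrC subrK.
- by move=> i j; apply: mod_partZ.
Qed.

Lemma loc_projE m k : loc_proj (frac f m k) =
  frac f (hproj (mod_part_direct gM) (mu + (k * eps)%N%:Z) m) k.
Proof.
apply/fracP; have [l e] := frac_repr f m k; exists l.
set r := repr _ in e *.
have fX j := alg_partX j f_eps.
rewrite !scalerA -!exprD -(hprojZ _ _ (fX (l + k)%N)) -(hprojZ _ _ (fX (l + r.2)%N)).
rewrite e; congr (hproj _ _ _); lia.
Qed.

End Piece.

End GradedLoc.

Section LocProj.
Variables (R S : comPzRingType) (gS : standardGradedAlgebra R S).
Variables (M : lmodType S) (gM : gradedModule gS M) (mu : int).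
Local Notation hpr := (hproj (mod_part_direct gM)).

Lemma loc_projD f eps (f_eps : alg_part gS eps f) (z w : loc M f) :
  loc_proj gM eps mu (z + w) = loc_proj gM eps mu z + loc_proj gM eps mu w.
Proof.
elim/frac_ind: z => m k; elim/frac_ind: w => m' k'.
rewrite fracD !(loc_projE _ _ f_eps) fracD raddfD /=.
have fX j := alg_partX j f_eps.
rewrite -(hprojZ gM _ _ (fX k')) -(hprojZ gM _ _ (fX k)).
by congr (frac _ (hpr _ _ + hpr _ _) _); lia.
Qed.

Lemma loc_proj0 f eps : alg_part gS eps f -> loc_proj gM eps mu (0 : loc M f) = 0.
Proof.
move=> f_eps; apply: (@addrI _ (loc_proj gM eps mu 0)).
by rewrite -loc_projD // !addr0.
Qed.

Lemma loc_projZ f eps s (f_eps : alg_part gS eps f) (z : loc M f) :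
  alg_part gS 0%N s -> loc_proj gM eps mu (s *: z) = s *: loc_proj gM eps mu z.
Proof.
move=> s0; elim/frac_ind: z => m k; rewrite fracZ !(loc_projE _ _ f_eps) fracZ.
by rewrite -(hprojZ gM _ _ s0) add0r.
Qed.

Lemma loc_proj_id f eps (f_eps : alg_part gS eps f) (z : loc M f) :
  loc_part gM eps mu z -> loc_proj gM eps mu z = z.
Proof. by move=> [m [k [mk ->]]]; rewrite (loc_projE _ _ f_eps) hproj_id. Qed.

Lemma loc_proj_part f eps (f_eps : alg_part gS eps f) (z : loc M f) :
  loc_part gM eps mu (loc_proj gM eps mu z).
Proof.
elim/frac_ind: z => m k; rewrite (loc_projE _ _ f_eps).
by exists (hpr (mu + (k * eps)%N%:Z) m), k; split=> //; apply: hproj_in.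
Qed.

Lemma loc_proj_res f h eps eta (z : loc M f) :
  alg_part gS eps f -> alg_part gS eta h ->
  loc_proj gM (eps + eta) mu (loc_res h (f * h) z) =
  loc_res h (f * h) (loc_proj gM eps mu z).
Proof.
move=> f_eps h_eta; elim/frac_ind: z => m k.
rewrite (loc_resE (erefl _)) (loc_projE _ _ f_eps).
rewrite (loc_projE _ _ (alg_partM f_eps h_eta)) (loc_resE (erefl _)).
rewrite -(hprojZ gM _ _ (alg_partX k h_eta)).
by congr (frac _ (hpr _ _) _); lia.
Qed.

End LocProj.

(** * The Cech complex of the graded module in one degree *)

Section CechPieces.
Variables (R S : comPzRingType) (gS : standardGradedAlgebra R S).
Variables (M : lmodType S) (gM : gradedModule gS M) (mu : int).
Variables (n : nat) (y : 'I_n -> S) (e : 'I_n -> nat).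
Hypothesis y_homog : forall i, alg_part gS (e i) (y i).
Local Notation deg J := (\sum_(i in J) e i)%N.
Implicit Types (c b : cech y M) (q : nat) (J : {set 'I_n}).

Lemma set_prod_part J : alg_part gS (deg J) (set_prod y J).
Proof. exact: alg_part_prod. Qed.

Lemma deg_D1 J i : i \in J -> (deg J = deg (J :\ i) + e i)%N.
Proof. by move=> iJ; rewrite (big_setD1 i) //= addnC. Qed.

Lemma sign_part k : alg_part gS 0%N ((-1) ^+ k).
Proof.
by rewrite alg_part0; exists ((-1) ^+ k) => //; rewrite rmorphXn rmorphN1.
Qed.

Definition cech_proj c : cech y M :=
  [ffun J : {set 'I_n} => loc_proj gM (deg J) mu (c J)].

Lemma cech_proj_part c : cech_part gM y e mu (cech_proj c).
Proof. by move=> J; rewrite ffunE; apply: loc_proj_part; apply: set_prod_part. Qed.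

Lemma cech_proj_id c : cech_part gM y e mu c -> cech_proj c = c.
Proof.
move=> cP; apply/ffunP=> J; rewrite ffunE (loc_proj_id (set_prod_part J)) //.
Qed.

Lemma cech_proj_diff c : cech_diff (cech_proj c) = cech_proj (cech_diff c).
Proof.
apply/ffunP=> J; rewrite [RHS]ffunE !ffunE.
have pJ := set_prod_part J.
rewrite (big_morph _ (loc_projD gM mu pJ) (loc_proj0 gM mu pJ)).
apply: eq_bigr => i iJ; rewrite ffunE loc_projZ //; last exact: sign_part.
congr (_ *: _); rewrite (deg_D1 iJ).
have pJi := set_prod_part (J :\ i).
rewrite (set_prodD1 y iJ); symmetry; exact: loc_proj_res.
Qed.

Lemma cech_diff_part c :
  cech_part gM y e mu c -> cech_part gM y e mu (cech_diff c).
Proof. by move=> /cech_proj_id <-; rewrite cech_proj_diff; apply: cech_proj_part. Qed.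

Definition piece q : {pred cech y M} :=
  fun c => `[< cochain q c /\ cech_part gM y e mu c >].

Lemma piece_closed q : zmod_closed (piece q).
Proof.
split=> [|x z /asboolP[x1 x2] /asboolP[z1 z2]]; apply/asboolP; split.
- by move=> J _; rewrite ffunE.
- by move=> J; rewrite ffunE; apply: loc_part_0.
- by move=> J qJ; rewrite !ffunE x1 ?z1 // subrr.
- move=> J; have := loc_partB (set_prod_part J) (x2 J) (z2 J).
  by rewrite !ffunE.
Qed.

Definition piece_zmod q : zmodClosed (cech y M) :=
  HB.pack (piece q) (GRing.isZmodClosed.Build _ _ (piece_closed q)).

Lemma piece_zmodZ q t c :
  c \in piece_zmod q -> scal gS t *: c \in piece_zmod q.
Proof.
move=> /asboolP[c1 c2]; apply/asboolP; split=> J.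
  by move=> qJ; rewrite ffunE c1 ?scaler0.
by rewrite ffunE; apply: loc_partZ; apply: c2.
Qed.

Definition cech_piece q := rsubmod (@piece_zmodZ q).

Definition piece_val q (x : cech_piece q) : cech y M := val x.

Lemma piece_embedding q : semi_embedding (scal gS) (@piece_val q).
Proof. exact: rsubmod_embedding. Qed.

Lemma piece_valP q (x : cech_piece q) :
  cochain q (piece_val x) /\ cech_part gM y e mu (piece_val x).
Proof. exact/asboolP/(valP x). Qed.

Lemma pieceP q c : cochain q c -> cech_part gM y e mu c ->
  exists x : cech_piece q, piece_val x = c.
Proof.
move=> c1 c2; have cP : c \in piece_zmod q by apply/asboolP.
by exists (exist (fun c => c \in piece_zmod q) c cP).
Qed.

Lemma piece_diff q : exists d : {linear cech_piece q -> cech_piece q.+1},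
  forall x, piece_val (d x) = cech_diff (piece_val x).
Proof.
apply: (lift_linear (piece_embedding q) (piece_embedding q.+1)) => x.
have [x1 x2] := piece_valP x; apply: pieceP; last exact: cech_diff_part.
by apply: cochain_pred_diff => J qJ; apply: x1 => qE; apply: qJ; rewrite qE.
Qed.

(** A homogeneous cocycle that is a coboundary bounds a homogeneous cochain:
    project any primitive to degree mu. Thus the vanishing of the degree mu part
    of the cohomology is the exactness of the degree mu part of the complex. *)
Lemma cohomology_part_exact q c : cohomology_part gM y e q mu = [set 0] ->
  cochain q c -> cech_part gM y e mu c -> cech_diff c = 0 ->
  exists b, [/\ cochain_pred q b, cech_part gM y e mu b & cech_diff b = c].
Proof.
move=> H0 c1 c2 c3.
have cz : cocycle q c by apply/asboolP.
pose z : cocycles y M q := exist _ c cz.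
have z0 : coho_class z = coho_class 0.
  have in0 x : cohomology_part gM y e q mu x -> x = 0 by rewrite H0.
  transitivity (0 : cohomology y M q); first by apply: in0; exists z.
  symmetry; apply: in0; exists 0 => // J.
  by rewrite ffunE; apply: loc_part_0.
move/coho_classP: z0; rewrite subr0 => /asboolP[b b1 b2].
exists (cech_proj b); split; last by rewrite cech_proj_diff -b2 cech_proj_id.
- by move=> J qJ; rewrite ffunE b1 // loc_proj0 //; apply: set_prod_part.
- exact: cech_proj_part.
Qed.

(** The inclusion of the summand with index J into the module of all cochains. *)
Definition cech_single J (z : loc M (set_prod y J)) : cech y M :=
  [ffun K => dfwith (fun K : {set 'I_n} => 0 : loc M (set_prod y K)) z K].

Lemma cech_single_in J z : cech_single z J = z :> loc M (set_prod y J).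
Proof. by rewrite ffunE dfwith_in. Qed.

Lemma cech_single_out J (z : loc M (set_prod y J)) K :
  J != K -> cech_single z K = 0.
Proof. by move=> JK; rewrite ffunE dfwith_out. Qed.

Lemma cech_single_linear J : linear (@cech_single J).
Proof.
move=> t z w; apply/ffunP=> K; have [<-|JK] := eqVneq J K.
  by rewrite [RHS]ffunE [in RHS]ffunE !cech_single_in.
by rewrite [RHS]ffunE [in RHS]ffunE !cech_single_out // scaler0 addr0.
Qed.

HB.instance Definition _ J := GRing.isLinear.Build S _ _ _ (@cech_single J)
  (@cech_single_linear J).

Lemma cech_single_cochain J (z : loc M (set_prod y J)) :
  cochain #|J| (cech_single z).
Proof. by move=> K; have [<-//|JK] := eqVneq J K; rewrite cech_single_out. Qed.

Lemma cech_single_part J (z : loc M (set_prod y J)) :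
  loc_part gM (deg J) mu z -> cech_part gM y e mu (cech_single z).
Proof.
move=> zJ K; have [<-|JK] := eqVneq J K; first by rewrite cech_single_in.
by rewrite cech_single_out //; apply: loc_part_0.
Qed.

(** The index sets that are obtained from the empty one by adding an element are
    the singletons, and the sign is 1 for each of them. *)
Lemma cech_diff_single0 m :
  cech_diff (@cech_single finset.set0 (frac _ m 0)) =
  \sum_(i < n) cech_single (frac (set_prod y [set i]%SET) m 0).
Proof.
apply/ffunP=> J; rewrite cech_sumE ffunE.
rewrite (bigID (fun i => J == [set i]%SET)).
rewrite [RHS](bigID (fun i => J == [set i]%SET)) /=.
congr (_ + _); last first.
  rewrite !big1 // => i; first by move=> iJ; rewrite cech_single_out // eq_sym.
  move=> /andP[iJ Ji]; rewrite cech_single_out; last first.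
    apply: contraNneq Ji => Ji0; apply/eqP/setP=> j.
    have := in_setD1 j J i; rewrite -Ji0 !inE.
    by case: eqP => [->|_] /= e0; [rewrite iJ|rewrite -e0].
  by rewrite -(frac0 _ _ 0) (loc_resE (set_prodD1 y iJ)) scaler0 frac0 scaler0.
apply: eq_big => i; first by apply: andb_idl => /eqP->; rewrite !inE.
case/andP=> iJ /eqP JE; subst J; rewrite cech_single_in.
rewrite (_ : #|_| = 0%N); last first.
  by apply: eq_card0 => j; rewrite !inE; case: eqP => [->|//]; rewrite ltnn.
rewrite expr0 scale1r.
have -> : [set i]%SET :\ i = finset.set0 by apply/setP=> j; rewrite !inE andNb.
rewrite cech_single_in loc_resE ?expr0 ?scale1r //.
by rewrite /set_prod big_set1 big_set0 mul1r.
Qed.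

End CechPieces.

(** * Vanishing for the localized pieces *)

Section LocPiece.
Variables (R S : comPzRingType) (gS : standardGradedAlgebra R S).
Variables (r : nat) (a : 'I_r -> R).
Variables (M : lmodType S) (gM : gradedModule gS M).
Local Notation comp := (component gM).

Definition piece_of_loc f eps mu (f_eps : alg_part gS eps f)
  (z : loc_piece gM mu f_eps) : loc M f := val z.

Lemma loc_piece_embedding f eps mu (f_eps : alg_part gS eps f) :
  semi_embedding (scal gS) (@piece_of_loc f eps mu f_eps).
Proof. exact: rsubmod_embedding. Qed.

Lemma loc_pieceP f eps mu (f_eps : alg_part gS eps f) (z : loc M f) :
  loc_part gM eps mu z -> exists x : loc_piece gM mu f_eps, piece_of_loc x = z.
Proof.
move=> zP; have zin : z \in loc_part_zmod gM mu f_eps by apply/asboolP.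
by exists (exist (fun z => z \in loc_part_zmod gM mu f_eps) z zin).
Qed.

Lemma loc_piece_valP f eps mu (f_eps : alg_part gS eps f)
    (x : loc_piece gM mu f_eps) : loc_part gM eps mu (piece_of_loc x).
Proof. exact/asboolP/(valP x). Qed.

(** The degree mu part of the localization at f is the colimit of the components
    of degrees mu + l * eps under multiplication by f, and these degrees become
    large. *)
Lemma acyclic_loc_piece f eps mu (f_eps : alg_part gS eps f) p :
  (0 < eps)%N \/ f = 0 ->
  (exists mu0, forall nu, mu0 <= nu -> acyclic a (comp nu) p) ->
  acyclic a (loc_piece gM mu f_eps) p.
Proof.
have [vI vD vZ] := loc_piece_embedding mu f_eps.
have v0 : piece_of_loc (0 : loc_piece gM mu f_eps) = 0 by [].
move=> [eps_gt0|f0] [mu0 acmu0]; last first.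
  apply: acyclic_zero => x; apply: vI; rewrite v0.
  elim/frac_ind: (piece_of_loc x) => m k; rewrite -(frac0 _ f 0); apply/fracP.
  by exists 1%N; rewrite expr1 f0 !scale0r.
pose G l := comp (mu + (l * eps)%N%:Z).
have phiP l : exists g : {linear G l -> loc_piece gM mu f_eps},
    forall x, piece_of_loc (g x) = frac_lin f l (comp_val x).
  apply: (lift_linear (comp_embedding gM _) (loc_piece_embedding mu f_eps)) => x.
  apply: loc_pieceP; exists (comp_val x), l; split=> //; exact: comp_valP.
pose phi l := sval (cid (phiP l)).
have phiE l x : piece_of_loc (phi l x) = frac f (comp_val x) l.
  exact: (svalP (cid (phiP l)) x).
apply: (acyclic_colim (phi := phi)) => [v|l w w0].
  have repr_v K : exists mk : M * nat, mod_part gM (mu + (mk.2 * eps)%N%:Z) mk.1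
      /\ piece_of_loc (v K) = frac f mk.1 mk.2.
    by have [m [k h]] := loc_piece_valP (v K); exists (m, k).
  pose mk K := sval (cid (repr_v K)); have mkP K := svalP (cid (repr_v K)).
  pose l := (\sum_(K : {set 'I_r}) (mk K).2)%N.
  have lE K : ((l - (mk K).2) + (mk K).2 = l)%N.
    by rewrite subnK // /l (bigD1 K) //= leq_addr.
  have gP K : exists g : G l, comp_val g = f ^+ (l - (mk K).2) *: (mk K).1.
    by apply: compP; rewrite -(lE K) addnK; apply: mod_partX => //; case: (mkP K).
  exists l, (fun K => sval (cid (gP K))) => K; apply: vI; rewrite phiE.
  rewrite (svalP (cid (gP K))) -{2}(lE K) frac_mul.
  by case: (mkP K) => _ ->.
have kill K : exists s, f ^+ s *: comp_val (w K) = 0.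
  have := phiE l (w K); rewrite w0 v0 -(frac0 _ f 0) => /fracP[s].
  by rewrite !expr0 !scale1r !scaler0 => e; exists s.
pose s K := sval (cid (kill K)); have sP K := svalP (cid (kill K)).
(* The sum makes f ^+ k kill all the w K, the second summand brings the
   degree above mu0. *)
pose k := ((\sum_(K : {set 'I_r}) s K) + `|mu0 - mu|)%N.
have [|tau tauE] := @comp_mul _ _ _ _ gM (mu + (l * eps)%N%:Z)
  (mu + ((l + k) * eps)%N%:Z) _ _ (alg_partX k f_eps); first by lia.
have [[cI _ _] [cI' _ _]] := (comp_embedding gM (mu + (l * eps)%N%:Z),
  comp_embedding gM (mu + ((l + k) * eps)%N%:Z)).
exists (l + k)%N, tau; split.
- by move=> x; apply: vI; rewrite !phiE tauE addnC frac_mul.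
- move=> K; apply: cI'; rewrite tauE.
  have -> : k = ((k - s K) + s K)%N.
    by rewrite subnK // /k (bigD1 K) //= -!addnA leq_addr.
  by rewrite exprD -scalerA (sP K) scaler0.
- apply: acmu0; rewrite /k; nia.
Qed.

End LocPiece.

(** * The double complex *)

Section DoubleComplex.
Variables (R S : comPzRingType) (gS : standardGradedAlgebra R S).
Variables (r : nat) (a : 'I_r -> R).
Variables (M : lmodType S) (gM : gradedModule gS M).
Local Notation comp := (component gM).
Variables (n : nat) (y : 'I_n -> S) (e : 'I_n -> nat).
Hypothesis y_homog : forall i, alg_part gS (e i) (y i).
Hypothesis y_irrelevant : forall i, irrelevant_ideal gS (y i).
Local Notation deg J := (\sum_(i in J) e i)%N.

Lemma y_deg0 i : e i = 0%N -> y i = 0.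
Proof.
by move=> ei0; apply: (irrelevant_part0 (y_irrelevant i)); rewrite -ei0.
Qed.

(** For q > 0 the cochains of degree q are the direct sum of the localizations at
    nonempty products of generators, whose degree is positive unless the product
    is zero. *)
Lemma acyclic_cech_piece mu q p : (0 < q)%N ->
  (exists mu0, forall nu, mu0 <= nu -> acyclic a (comp nu) p) ->
  acyclic a (cech_piece gM mu y_homog q) p.
Proof.
move=> q_gt0 ac; pose T := {J : {set 'I_n} | #|J| == q}.
pose L (t : T) := loc_piece gM mu (set_prod_part y_homog (val t)).
have prP t : exists g : {linear cech_piece gM mu y_homog q -> L t},
    forall x, piece_of_loc (g x) = piece_val x (val t).
  have ev_lin : linear (fun c : cech y M => c (val t)).
    by move=> b c c'; rewrite !ffunE.
  pose ev : {linear cech y M -> loc M (set_prod y (val t))} := HB.pack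
    (fun c : cech y M => c (val t)) (GRing.isLinear.Build _ _ _ _ _ ev_lin).
  apply: (lift_linear (u := ev) (piece_embedding gM mu y_homog q)
    (loc_piece_embedding gM mu _)) => x.
  by apply: loc_pieceP; have [_ xP] := piece_valP x; apply: xP.
have injP t : exists g : {linear L t -> cech_piece gM mu y_homog q},
    forall x, piece_val (g x) = cech_single (piece_of_loc x).
  apply: (lift_linear (u := @cech_single _ M _ y (val t))
    (loc_piece_embedding gM mu _) (piece_embedding gM mu y_homog q)) => x.
  apply: pieceP; last by apply: cech_single_part; apply: loc_piece_valP.
  by rewrite -{1}(eqP (valP t)); apply: cech_single_cochain.
pose pr t := sval (cid (prP t)); pose inj t := sval (cid (injP t)).
have prE t x : piece_of_loc (pr t x) = piece_val x (val t).
  exact: (svalP (cid (prP t)) x).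
have injE t x : piece_val (inj t x) = cech_single (piece_of_loc x).
  exact: (svalP (cid (injP t)) x).
apply: (acyclic_sum (pr := pr) (inj := inj)) => [x|t]; last first.
  apply: acyclic_loc_piece => //=; case: (posnP (deg (val t))) => d0; [right|by left].
  have /set0Pn[i it] : val t != finset.set0 by rewrite -card_gt0 (eqP (valP t)).
  rewrite /set_prod (bigD1 i) //= y_deg0 ?mul0r //.
  by apply/eqP; rewrite -leqn0 -d0 (bigD1 i) //= leq_addr.
have [vI vD _] := piece_embedding gM mu y_homog q.
have v0 : piece_val (0 : cech_piece gM mu y_homog q) = 0 by [].
apply: vI; rewrite (big_morph _ vD v0).
apply/ffunP=> J; rewrite cech_sumE.
have [qJ|qJ] := eqVneq #|J| q; last first.
  have [-> //] := piece_valP x; last exact/eqP.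
  rewrite big1 // => t _; rewrite injE cech_single_out //.
  by apply: contraNneq qJ => <-; apply: (valP t).
have [t <-] : exists t : T, val t = J by exists (exist _ J (introT eqP qJ)).
rewrite (bigD1 t) //= [X in _ + X]big1 ?addr0 => [|t' t't].
  by rewrite injE prE cech_single_in.
by rewrite injE cech_single_out.
Qed.

Lemma comp_single mu (J : {set 'I_n}) k :
  exists g : {linear comp (mu + (k * deg J)%N%:Z) ->
    cech_piece gM mu y_homog #|J|},
  forall m, piece_val (g m) = cech_single (frac (set_prod y J) (comp_val m) k).
Proof.
apply: (lift_linear (u := @cech_single _ M _ y J \o frac_lin (set_prod y J) k)
  (comp_embedding gM _) (piece_embedding gM mu y_homog _)) => m.
apply: pieceP; first exact: cech_single_cochain.
apply: cech_single_part; exists (comp_val m), k; split=> //; exact: comp_valP.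
Qed.

(** The map from the degree mu component to the 1-cochains. It replaces the
    module of 0-cochains, the localization at the empty product, by the component
    itself. *)
Definition augmentation mu (g : comp mu -> cech_piece gM mu y_homog 1) :=
  forall m, piece_val (g m) =
    cech_diff (cech_single (frac (set_prod y finset.set0) (comp_val m) 0)).

Lemma augmentation_ex mu :
  exists g : {linear comp mu -> cech_piece gM mu y_homog 1}, augmentation g.
Proof.
apply: (lift_linear (u := @cech_diff _ _ y M \o
   (@cech_single _ M _ y finset.set0 \o frac_lin (set_prod y finset.set0) 0))
  (comp_embedding gM _) (piece_embedding gM mu y_homog _)) => m /=.
apply: pieceP; last apply: cech_diff_part => //.
  apply: cochain_pred_diff => J qJ; apply: cech_single_out.
  by apply: contra_not_neq qJ => <-; rewrite cards0.
apply: cech_single_part; exists (comp_val m), 0%N; split=> //.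
by rewrite mul0n addr0; apply: comp_valP.
Qed.

(** The staircase for the double complex: the cohomology of degree p of the
    component of degree mu embeds into that of the 1-cochains of degree mu. *)
Lemma bounds_of_augmented mu p
    (g : {linear comp mu -> cech_piece gM mu y_homog 1}) :
  augmentation g ->
  (forall i, (i < p)%N ->
     exists mu0, forall nu, mu0 <= nu -> acyclic a (comp nu) i) ->
  (forall q, (q <= p)%N -> cohomology_part gM y e q mu = [set 0]) ->
  forall c : cech a (comp mu), cochain p c -> bounds p (cech_map g c) ->
  bounds p c.
Proof.
move=> gE ac H0.
pose G q : lmodType R := cech_piece gM mu y_homog q.+1.
have deltaP q := piece_diff gM mu y_homog q.+1.
pose delta q : {linear G q -> G q.+1} := sval (cid (deltaP q)).
have deltaE q x : piece_val (delta q x) = cech_diff (piece_val x).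
  exact: (svalP (cid (deltaP q)) x).
have vI q : injective (@piece_val _ _ gS _ gM mu _ _ _ y_homog q).
  by have [] := piece_embedding gM mu y_homog q.
have v0 q : piece_val (0 : cech_piece gM mu y_homog q) = 0 by [].
have exq q (x : cech_piece gM mu y_homog q) : (q <= p)%N ->
    cech_diff (piece_val x) = 0 -> exists b,
    [/\ cochain_pred q b, cech_part gM y e mu b & cech_diff b = piece_val x].
  move=> qp x0; have [x1 x2] := piece_valP x.
  exact: (cohomology_part_exact y_homog (H0 q qp)).
apply: (staircase (delta := delta)).
- by move=> x; apply: vI; rewrite deltaE gE cech_diff_sqr.
- by move=> q x; apply: vI; rewrite !deltaE cech_diff_sqr.
- by move=> i q ip; apply: acyclic_cech_piece => //; apply: ac.
- move=> m gm0.
  have := gE m; rewrite gm0 v0; set z := cech_single _ => z0.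
  have [||b [b1 _ b2]] := cohomology_part_exact y_homog (H0 0%N (leq0n p))
    (c := z) _ _ (esym z0).
  + rewrite -(cards0 'I_n); exact: cech_single_cochain.
  + apply: cech_single_part; exists (comp_val m), 0%N; split=> //.
    by rewrite mul0n addr0; apply: comp_valP.
  have b0 : b = 0 by apply/ffunP=> J; rewrite b1 // ffunE.
  have : z finset.set0 = 0 by rewrite -b2 b0 linear0 ffunE.
  rewrite /z cech_single_in -(frac0 _ _ 0) => /fracP[l].
  have -> : set_prod y finset.set0 = 1 by rewrite /set_prod big_set0.
  by rewrite expr1n !scale1r => m0; apply: val_inj.
- move=> p_gt0 x x0.
  have [|b [b1 b2 b3]] := exq 1%N x p_gt0; first by rewrite -deltaE x0.
  have [m [k [mk bE]]] := b2 finset.set0.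
  rewrite big_set0 muln0 addr0 in mk; have [m' m'E] := compP mk.
  exists m'; apply: vI; rewrite gE -b3; congr cech_diff.
  apply/ffunP=> J; have [<-|J0] := eqVneq finset.set0 J.
    rewrite cech_single_in bE m'E -(frac_mul (set_prod y finset.set0) k m 0).
    by rewrite addn0 /set_prod big_set0 expr1n scale1r.
  rewrite cech_single_out // b1 // => -[] /eqP; rewrite cards_eq0 eq_sym.
  exact/negP.
move=> j jp x x0.
have [|b [b1 b2 b3]] := exq j.+2 x jp; first by rewrite -deltaE x0.
have [|w wE] := @pieceP _ _ _ _ gM mu _ _ _ y_homog j.+1 b _ b2.
  by move=> J Jj; apply: b1 => -[].
by exists w; apply: vI; rewrite deltaE wE.
Qed.

(** Once H^p vanishes for the component of degree k + mu, a class in H^p of the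
    component of degree mu is killed by every homogeneous element of degree at
    least k, because such an element is a sum of multiples of elements of
    degree k. *)
Lemma acyclic_bounds_mul mu k p (c : cech a (comp mu)) : cochain p c ->
  cech_diff c = 0 -> acyclic a (comp (k%:Z + mu)) p ->
  forall l s, (k <= l)%N -> alg_part gS l s ->
  forall g : {linear comp mu -> comp (l%:Z + mu)},
    (forall m, comp_val (g m) = s *: comp_val m) -> bounds p (cech_map g c).
Proof.
move=> c1 c2 ac l s kl; rewrite -(subnK kl).
move: (l - k)%N s => {l kl}; elim=> [|j IHj] s sj g gE.
  apply: ac; first exact: cech_map_cochain.
  by rewrite cech_map_diff c2 linear0.
have [vI vD _] := comp_embedding gM ((j.+1 + k)%N%:Z + mu).
(* The first condition provides the multiplications by the terms of a sum. *)
pose P u := alg_part gS (j.+1 + k) u /\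
  forall g : {linear comp mu -> comp ((j.+1 + k)%N%:Z + mu)},
    (forall m, comp_val (g m) = u *: comp_val m) -> bounds p (cech_map g c).
suff [_ /(_ g gE) //] : P s.
apply: (@alg_part_succ_ind _ _ gS (j + k)%N P) => {s sj g gE} //.
- split; first exact: alg_part_0.
  move=> g gE; rewrite cech_map0; first exact: bounds0.
  by move=> x; apply: vI; rewrite gE scale0r.
- move=> s t [sj sP] [tj tP]; split; first exact: alg_partD.
  move=> g gE.
  have [gs gsE] := comp_mul gM sj (erefl (_ + mu)).
  have [gt gtE] := comp_mul gM tj (erefl (_ + mu)).
  rewrite (_ : cech_map g c = cech_map gs c + cech_map gt c).
    by apply: boundsD; [apply: sP|apply: tP].
  apply/ffunP=> K; rewrite !ffunE; elim/frac_ind: (c K) => m l.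
  rewrite !loc_mapE fracD -scalerDr frac_mul; congr frac.
  by apply: vI; rewrite vD gE gsE gtE scalerDl.
move=> s t s1 tj; split; first by rewrite addSn -add1n; apply: alg_partM.
move=> g gE.
have [gt gtE] := comp_mul gM tj (erefl (_ + mu)).
have [|gs gsE] := @comp_mul _ _ _ _ gM ((j + k)%N%:Z + mu) ((j.+1 + k)%N%:Z + mu)
  _ _ s1; first by lia.
rewrite (cech_map_eq (h := gs \o gt)); last first.
  by move=> m; apply: vI; rewrite gE /= gsE gtE scalerA.
by rewrite cech_map_comp; apply: cech_map_bounds; apply: (IHj t).
Qed.

(** The class dies in the localization at each generator y i: a large power of
    y i kills it by acyclic_bounds_mul, and y i is invertible there. *)
Lemma augmented_bounds mu k p
    (g : {linear comp mu -> cech_piece gM mu y_homog 1}) :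
  augmentation g ->
  acyclic a (comp (k%:Z + mu)) p ->
  forall c : cech a (comp mu), cochain p c -> cech_diff c = 0 ->
  bounds p (cech_map g c).
Proof.
move=> gE ac c c1 c2.
have [vI vD _] := piece_embedding gM mu y_homog 1.
have v0 : piece_val (0 : cech_piece gM mu y_homog 1) = 0 by [].
have psiP i l : exists psi : {linear comp ((l * e i)%N%:Z + mu) ->
    cech_piece gM mu y_homog 1}, forall m, piece_val (psi m) =
    cech_single (frac (set_prod y [set i]%SET) (comp_val m) l).
  have := comp_single mu [set i]%SET l.
  by rewrite big_set1 cards1 [_ + mu]addrC.
(* The successor makes the power vanish when y i = 0, also if k = 0. *)
pose l := k.+1.
have hP i : exists h : {linear comp mu -> comp ((l * e i)%N%:Z + mu)},
    forall m, comp_val (h m) = y i ^+ l *: comp_val m.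
  exact: comp_mul (alg_partX l (y_homog i)) (erefl _).
pose psi i := sval (cid (psiP i l)).
have psiE i m : piece_val (psi i m) =
    cech_single (frac (set_prod y [set i]%SET) (comp_val m) l).
  exact: (svalP (cid (psiP i l)) m).
pose h i := sval (cid (hP i)).
have hE i m : comp_val (h i m) = y i ^+ l *: comp_val m.
  exact: (svalP (cid (hP i)) m).
rewrite (cech_map_eq (h := fun m => \sum_i (psi i \o h i) m)); last first.
  move=> m; apply: vI; rewrite gE cech_diff_single0 (big_morph _ vD v0).
  apply: eq_bigr => i _; rewrite /= psiE hE; congr cech_single.
  by rewrite -[LHS](frac_mul _ l) addn0 /set_prod big_set1.
rewrite cech_map_sum; apply: bounds_sum => i _.
rewrite cech_map_comp; apply: cech_map_bounds.
case: (posnP (e i)) => [ei0|ei_gt0].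
  rewrite cech_map0; first exact: bounds0.
  by move=> m; apply: val_inj; rewrite [LHS]hE y_deg0 // expr0n scale0r.
apply: (acyclic_bounds_mul c1 c2 ac _ _ (hE i)); last exact: alg_partX.
by rewrite /l; nia.
Qed.

End DoubleComplex.

Theorem proposition3p1
    (R S : comPzRingType) (gS : standardGradedAlgebra R S)
    (* I = (a_0, ..., a_{r-1}) *)
    (r : nat) (a : 'I_r -> R)
    (* homogeneous generators of S_+ *)
    (n : nat) (y : 'I_n -> S) (e : 'I_n -> nat)
    (y_homog : forall i : 'I_n, alg_part gS (e i) (y i))
    (y_gen : ideal_span y = irrelevant_ideal gS)
    (M : lmodType S) (gM : gradedModule gS M) (d : int)
    (depth_large : exists mu0 : int, forall mu : int, mu0 <= mu ->
       (d%:E <= depth a (component gM mu))%E) :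
  (forall mu : int,
     (forall q : nat, q%:Z < d -> cohomology_part gM y e q mu = [set 0]) ->
     (d%:E <= depth a (component gM mu))%E) /\
  (forall mu : int,
     depth a (component gM mu) = d%:E ->
     (forall q : nat, q%:Z <= d -> cohomology_part gM y e q mu = [set 0]) ->
     forall nu : int, mu <= nu ->
     (depth a (component gM nu) <= d%:E)%E).
Proof.
have y_irr i : irrelevant_ideal gS (y i).
  rewrite -y_gen; exists (fun j => if j == i then 1 else 0).
  rewrite (bigD1 i) //= eqxx mul1r big1 ?addr0 // => j /negPf->.
  by rewrite mul0r.
have depth_ge0 N : (0%:E <= depth a N)%E.
  by apply/(depth_geP a N 0%N).
(* A negative d is less than every depth, so (i) is clear and (ii) vacuous. *)
case: d depth_large => [d|d] large; last first.
  split=> [mu _|mu mud]; last first.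
    by have := depth_ge0 (component gM mu); rewrite mud lee_fin; lia.
  by apply: le_trans (depth_ge0 _); rewrite lee_fin; lia.
have [mu0 ac_mu0] := large.
have ac i : (i < d)%N ->
    exists mu0, forall nu, mu0 <= nu -> acyclic a (component gM nu) i.
  by move=> id; exists mu0 => nu /ac_mu0/depth_geP; apply.
split=> [mu H0|mu mud H0 nu].
  apply/depth_geP => i id c c1 c2.
  have [g gE] := augmentation_ex gM y_homog mu.
  apply: (bounds_of_augmented y_irr gE) => //.
  - by move=> j ji; apply: ac; lia.
  - by move=> q qi; apply: H0; lia.
  apply: (acyclic_cech_piece (q := 1) y_irr) => //; first exact: ac.
    exact: cech_map_cochain.
  by rewrite cech_map_diff c2 linear0.
move=> munu; rewrite leNgt; apply/negP => lt_d.
have [k nuE] : exists k : nat, nu = k%:Z + mu by exists `|nu - mu|%N; lia.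
have ac_nu : acyclic a (component gM nu) d.
  have [[_ h] _] := depth_max a (component gM nu).
  by apply/acyclicP; exact: (h d lt_d).
rewrite nuE in ac_nu.
suff : (d.+1%:Z%:E <= depth a (component gM mu))%E by rewrite mud lee_fin; lia.
apply/depth_geP => i; rewrite ltnS leq_eqVlt => /orP[/eqP->|]; last first.
  by move: i; apply/depth_geP; rewrite mud.
move=> c c1 c2; have [g gE] := augmentation_ex gM y_homog mu.
apply: (bounds_of_augmented y_irr gE) => //.
exact: (augmented_bounds y_irr gE ac_nu).
Qed.
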